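(* There is an absolute constant $c>0$ such that the following holds. Let $n,\ell\ge 1$ be integers and let $Z_1,\dots,Z_n$ be i.i.d. copies of a random positive semidefinite matrix $Z\in\mathbb{R}^{\ell\times\ell}$ with mean $\Sigma=\mathbb{E}Z\neq 0$, such that for some $\eta\ge1$ and every $p\ge1$ and $u\in\mathbb{R}^\ell$, $$\left(\mathbb{E}\left(|u^\top Zu|^p\right)\right)^{1/p}\le\eta\,p\,\|u\|_\Sigma^2 .$$ Let $r_{\mathrm{eff}}(\Sigma)=\operatorname{tr}(\Sigma)/\|\Sigma\|_{\mathrm{op}}$. Then for any $t\ge0$, with probability at least $1-e^{-t}$, $$\left\|\frac1n\sum_{i=1}^nZ_i-\Sigma\right\|_{\mathrm{op}}\le c\,\eta\,\|\Sigma\|_{\mathrm{op}}\sqrt{\frac{2r_{\mathrm{eff}}(\Sigma)+t}{n}}\ \max\left\{1,\sqrt{\frac{r_{\mathrm{eff}}(\Sigma)+t/2}{n}}\right\}.$$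
   Context: Positive semidefinite matrices are symmetric. $\|u\|_\Sigma=\sqrt{u^\top\Sigma u}$ and $\|\cdot\|_{\mathrm{op}}$ is the operator (spectral) norm. *)

(* Defs.v *)
From HB Require Import structures.
From mathcomp Require Import all_boot all_order all_algebra.
From mathcomp Require Import all_classical all_reals all_analysis.

Set Implicit Arguments.
Unset Strict Implicit.
Unset Printing Implicit Defensive.

Import Order.TTheory GRing.Theory Num.Theory.
Import numFieldNormedType.Exports.

Local Open Scope classical_set_scope.
Local Open Scope ring_scope.

Definition qform (R : realType) (l : nat) (A : 'M[R]_l) (u : 'cV[R]_l) : R :=
  (u^T *m A *m u) 0 0.

Definition psdmx (R : realType) (l : nat) (A : 'M[R]_l) : Prop :=
  A^T = A /\ forall u : 'cV[R]_l, 0 <= qform A u.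

Definition mxseminorm (R : realType) (l : nat) (A : 'M[R]_l) (u : 'cV[R]_l) : R :=
  Num.sqrt (qform A u).

(* The library's norm on matrices is the entrywise maximum, not this one. *)
Definition eucl_norm (R : realType) (l : nat) (u : 'cV[R]_l) : R :=
  Num.sqrt (\sum_(i < l) u i 0 ^+ 2).

Definition opnorm (R : realType) (l : nat) (A : 'M[R]_l) : R :=
  sup [set eucl_norm (A *m u) | u in [set u : 'cV[R]_l | eucl_norm u <= 1]].

Definition reff (R : realType) (l : nat) (A : 'M[R]_l) : R := \tr A / opnorm A.

(* [{RV P >-> borel_mx R l}] is the type of random l x l matrices, measurable
   for the Borel sigma-algebra. *)
Notation borel_mx R l := (g_sigma_algebraType (@open 'M[R]_l)).

(* The carrier of [borel_mx R l] is ['M[R]_l]; this only recovers its algebraic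
   structure. *)
Definition mx_of (R : realType) (l : nat) (A : borel_mx R l) : 'M[R]_l := A.

Definition has_mean (d : measure_display) (T : measurableType d)
    (R : realType) (P : probability T R) (l : nat) (Z : T -> 'M[R]_l) (S : 'M[R]_l) : Prop :=
  forall i j : 'I_l,
    P.-integrable setT (EFin \o (fun x => Z x i j)) /\
    'E_P[fun x => Z x i j]%E = (S i j)%:E.

Definition identically_distributed (d1 d2 d' : measure_display)
    (T1 : measurableType d1) (T2 : measurableType d2) (T' : measurableType d')
    (R : realType) (P1 : probability T1 R) (P2 : probability T2 R)
    (X1 : {RV P1 >-> T'}) (X2 : {RV P2 >-> T'}) : Prop :=
  forall B : set T', measurable B -> distribution P1 X1 B = distribution P2 X2 B.

Definition mutually_independent (d d' : measure_display) (T : measurableType d)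
    (T' : measurableType d') (R : realType) (P : probability T R)
    (I : finType) (X : I -> {RV P >-> T'}) : Prop :=
  forall (J : {set I}) (B : I -> set T'),
    (forall i, i \in J -> measurable (B i)) ->
    P (\bigcap_(i in [set` J]) (X i @^-1` B i)) =
      (\prod_(i in J) P (X i @^-1` B i))%E.

(* Main.v *)
(* PAC-Bayes on a finite hypercube.  A unit vector u is replaced by a random
   theta = (1/N) sum_a eps_a, where the N sign vectors eps_a have independent
   coordinates with means u_i and N is comparable to the effective rank r; then
   E theta = u and E theta^T Sigma theta <= 2 ||Sigma||.  The law of theta has density at
   most exp(N <u, theta>) with respect to uniform signs, so by Jensen's inequality the
   average of exp(h) over uniform signs controls E h(theta, nu) uniformly in u and v,
   at the price 2N.  The function h is a multiple of theta^T A nu, with A the deviation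
   matrix, cut off outside the set where theta^T Sigma theta and nu^T Sigma nu are at
   most 64 ||Sigma||; there the moment assumption gives a Bernstein bound for the moment
   generating function, since |theta^T Z nu| <= (theta^T Z theta + nu^T Z nu) / 2.  The
   cut-off moves E theta by at most 1/4, so it costs 9/16 ||A||, absorbed in the
   left-hand side. *)

Require Import Defs.
From HB Require Import structures.
From mathcomp Require Import all_boot all_order all_algebra.
From mathcomp Require Import all_classical all_reals all_analysis.
From mathcomp Require Import finmap measurable_realfun ring lra.
Set Implicit Arguments.
Unset Strict Implicit.
Unset Printing Implicit Defensive.
Import Order.TTheory GRing.Theory Num.Theory.
Import numFieldNormedType.Exports.
Local Open Scope classical_set_scope.
Local Open Scope ring_scope.

(** * Bilinear forms and the operator norm *)

Definition dot {R : realType} {l : nat} (u v : 'cV[R]_l) : R := \sum_(i < l) u i 0 * v i 0.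

(** Written out as a double sum, linear in the entries of [A], so that measurability and integrals
    reduce to single entries. *)
Definition bil {R : realType} {l : nat} (A : 'M[R]_l) (u v : 'cV[R]_l) : R :=
  \sum_(i < l) \sum_(j < l) A i j * (u i 0 * v j 0).

Lemma bilE (R : realType) (l : nat) (A : 'M[R]_l) (u v : 'cV[R]_l) :
  bil A u v = dot u (A *m v).
Proof.
apply: eq_bigr => i _; rewrite mxE mulr_sumr; apply: eq_bigr => j _; ring.
Qed.

Lemma qform_bil (R : realType) (l : nat) (A : 'M[R]_l) (u : 'cV[R]_l) :
  qform A u = bil A u u.
Proof.
rewrite /qform -mulmxA mxE bilE.
by apply: eq_bigr => i _; rewrite !mxE.
Qed.

Lemma bilDl (R : realType) (l : nat) (A : 'M[R]_l) (u u' v : 'cV[R]_l) :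
  bil A (u + u') v = bil A u v + bil A u' v.
Proof.
rewrite /bil -big_split /=; apply: eq_bigr => i _.
rewrite -big_split /=; apply: eq_bigr => j _; rewrite mxE; ring.
Qed.

Lemma bilDr (R : realType) (l : nat) (A : 'M[R]_l) (u v v' : 'cV[R]_l) :
  bil A u (v + v') = bil A u v + bil A u v'.
Proof.
rewrite /bil -big_split /=; apply: eq_bigr => i _.
rewrite -big_split /=; apply: eq_bigr => j _; rewrite mxE; ring.
Qed.

Lemma bilZl (R : realType) (l : nat) (A : 'M[R]_l) (a : R) (u v : 'cV[R]_l) :
  bil A (a *: u) v = a * bil A u v.
Proof.
rewrite /bil mulr_sumr; apply: eq_bigr => i _.
rewrite mulr_sumr; apply: eq_bigr => j _; rewrite mxE; ring.
Qed.

Lemma bilZr (R : realType) (l : nat) (A : 'M[R]_l) (a : R) (u v : 'cV[R]_l) :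
  bil A u (a *: v) = a * bil A u v.
Proof.
rewrite /bil mulr_sumr; apply: eq_bigr => i _.
rewrite mulr_sumr; apply: eq_bigr => j _; rewrite mxE; ring.
Qed.

Lemma bil0l (R : realType) (l : nat) (A : 'M[R]_l) (v : 'cV[R]_l) : bil A 0 v = 0.
Proof. by rewrite -(scale0r 0) bilZl mul0r. Qed.

Lemma bil0r (R : realType) (l : nat) (A : 'M[R]_l) (v : 'cV[R]_l) : bil A v 0 = 0.
Proof. by rewrite -(scale0r 0) bilZr mul0r. Qed.

Lemma bil_suml (R : realType) (l : nat) (A : 'M[R]_l) (I : finType) (F : I -> 'cV[R]_l) v :
  bil A (\sum_i F i) v = \sum_i bil A (F i) v.
Proof. by apply: (big_morph (fun u => bil A u v)) => [u u'|]; [rewrite bilDl|rewrite bil0l]. Qed.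

Lemma bil_sumr (R : realType) (l : nat) (A : 'M[R]_l) (I : finType) (F : I -> 'cV[R]_l) u :
  bil A u (\sum_i F i) = \sum_i bil A u (F i).
Proof. by apply: (big_morph (bil A u)) => [v v'|]; [rewrite bilDr|rewrite bil0r]. Qed.

Lemma bil_summx (R : realType) (l n : nat) (A : 'I_n -> 'M[R]_l) (u v : 'cV[R]_l) :
  bil (\sum_i A i) u v = \sum_i bil (A i) u v.
Proof.
rewrite /bil [RHS]exchange_big; apply: eq_bigr => i _ /=.
rewrite [RHS]exchange_big; apply: eq_bigr => j _ /=.
by rewrite summxE mulr_suml.
Qed.

Lemma bilB (R : realType) (l : nat) (A B : 'M[R]_l) (u v : 'cV[R]_l) :
  bil (A - B) u v = bil A u v - bil B u v.
Proof.
rewrite /bil -sumrB; apply: eq_bigr => i _.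
rewrite -sumrB; apply: eq_bigr => j _; rewrite !mxE; ring.
Qed.

Lemma bilZ (R : realType) (l : nat) (A : 'M[R]_l) (a : R) (u v : 'cV[R]_l) :
  bil (a *: A) u v = a * bil A u v.
Proof.
rewrite /bil mulr_sumr; apply: eq_bigr => i _.
rewrite mulr_sumr; apply: eq_bigr => j _; rewrite mxE; ring.
Qed.

Lemma bil_sym (R : realType) (l : nat) (A : 'M[R]_l) (u v : 'cV[R]_l) :
  A^T = A -> bil A u v = bil A v u.
Proof.
move=> At; rewrite /bil [LHS]exchange_big /=; apply: eq_bigr => i _; apply: eq_bigr => j _.
by rewrite -{1}At mxE [u _ _ * _]mulrC.
Qed.

Lemma bil1 (R : realType) (l : nat) (u v : 'cV[R]_l) : bil 1%:M u v = dot u v.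
Proof. by rewrite bilE mul1mx. Qed.

(** Expanding the form at [u + v] and at [u - v], both nonnegative, bounds the cross term from
    either side. *)
Lemma psdmx_bil_le (R : realType) (l : nat) (A : 'M[R]_l) (u v : 'cV[R]_l) :
  psdmx A -> `|bil A u v| <= (qform A u + qform A v) / 2.
Proof.
case=> At A0; have vu := bil_sym v u At.
have := A0 (u + v); have := A0 (u + (-1) *: v).
rewrite !qform_bil !bilDl !bilDr !bilZl !bilZr vu => h1 h2.
by rewrite ler_norml; apply/andP; split; lra.
Qed.

(** * Euclidean norm and the Cauchy-Schwarz inequality *)

Lemma eucl_norm_sq (R : realType) (l : nat) (u : 'cV[R]_l) : eucl_norm u ^+ 2 = dot u u.
Proof.
rewrite sqr_sqrtr; first by apply: eq_bigr => i _; rewrite expr2.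
by apply: sumr_ge0 => i _; exact: sqr_ge0.
Qed.

Lemma eucl_norm_ge0 (R : realType) (l : nat) (u : 'cV[R]_l) : 0 <= eucl_norm u.
Proof. exact: sqrtr_ge0. Qed.

Lemma eucl_norm_le (R : realType) (l : nat) (u : 'cV[R]_l) (c : R) :
  0 <= c -> (eucl_norm u <= c) = (dot u u <= c ^+ 2).
Proof. by move=> c0; rewrite -eucl_norm_sq ler_pXn2r // nnegrE eucl_norm_ge0. Qed.

Lemma dotE (R : realType) (l : nat) (u v : 'cV[R]_l) : dot u v = bil 1%:M u v.
Proof. by rewrite bil1. Qed.

Lemma dot_ge0 (R : realType) (l : nat) (u : 'cV[R]_l) : 0 <= dot u u.
Proof. by rewrite -eucl_norm_sq sqr_ge0. Qed.

Lemma dotC (R : realType) (l : nat) (u v : 'cV[R]_l) : dot u v = dot v u.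
Proof. by apply: eq_bigr => i _; rewrite mulrC. Qed.

Lemma eucl_normZ (R : realType) (l : nat) (a : R) (u : 'cV[R]_l) :
  eucl_norm (a *: u) = `|a| * eucl_norm u.
Proof.
apply/eqP; rewrite -(@eqrXn2 _ 2%N) ?mulr_ge0 ?eucl_norm_ge0 //.
by rewrite exprMn !eucl_norm_sq real_normK ?num_real // !dotE bilZl bilZr; apply/eqP; ring.
Qed.

Lemma eucl_norm_eq0 (R : realType) (l : nat) (u : 'cV[R]_l) : eucl_norm u = 0 -> u = 0.
Proof.
move=> u0; have /eqP := eucl_norm_sq u; rewrite u0 expr0n /= eq_sym /dot.
rewrite psumr_eq0 => [/allP u2|i _]; last by rewrite -expr2 sqr_ge0.
apply/matrixP => i j; rewrite (ord1 j) mxE; apply/eqP.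
by have := u2 i (mem_index_enum _); rewrite -expr2 sqrf_eq0.
Qed.

(** This is [psdmx_bil_le] for the identity matrix at normalized vectors; zero vectors are treated
    apart. *)
Lemma dot_le (R : realType) (l : nat) (u v : 'cV[R]_l) :
  `|dot u v| <= eucl_norm u * eucl_norm v.
Proof.
have cs (x y : 'cV[R]_l) : eucl_norm x = 1 -> eucl_norm y = 1 -> `|dot x y| <= 1.
  move=> x1 y1; have := @psdmx_bil_le R l 1%:M x y.
  rewrite !qform_bil !bil1 -!eucl_norm_sq x1 y1 expr1n => H.
  suff P : psdmx (1%:M : 'M[R]_l) by apply: le_trans (H P) _; lra.
  by split=> [|z]; rewrite ?trmx1 // qform_bil bil1 dot_ge0.
have [/eqP/eucl_norm_eq0->|u0] := boolP (eucl_norm u == 0).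
  by rewrite dotE bil0l normr0 mulr_ge0 ?eucl_norm_ge0.
have [/eqP/eucl_norm_eq0->|v0] := boolP (eucl_norm v == 0).
  by rewrite dotE bil0r normr0 mulr_ge0 ?eucl_norm_ge0.
have n1 (x : 'cV[R]_l) : eucl_norm x != 0 -> eucl_norm ((eucl_norm x)^-1 *: x) = 1.
  by move=> x0; rewrite eucl_normZ ger0_norm ?invr_ge0 ?eucl_norm_ge0 // mulVf.
have := cs _ _ (n1 _ u0) (n1 _ v0).
rewrite dotE bilZl bilZr bil1 !normrM !normfV !(ger0_norm (eucl_norm_ge0 _)).
rewrite mulrA -invfM mulrC ler_pdivrMr; last by rewrite mulr_gt0 // lt_neqAle eq_sym ?u0 ?v0 eucl_norm_ge0.
by rewrite mul1r.
Qed.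

Lemma eucl_normD (R : realType) (l : nat) (u v : 'cV[R]_l) :
  eucl_norm (u + v) <= eucl_norm u + eucl_norm v.
Proof.
rewrite eucl_norm_le ?addr_ge0 ?eucl_norm_ge0 // dotE bilDl !bilDr !bil1 (dotC v u).
rewrite sqrrD !eucl_norm_sq; have := ler_normlW (dot_le u v); lra.
Qed.

(** * Frobenius bound and characterizations of the operator norm *)

Definition frob {R : realType} {l : nat} (A : 'M[R]_l) : R :=
  \sum_(i < l) \sum_(j < l) A i j ^+ 2.

Lemma frob_ge0 (R : realType) (l : nat) (A : 'M[R]_l) : 0 <= frob A.
Proof. by apply: sumr_ge0 => i _; apply: sumr_ge0 => j _; exact: sqr_ge0. Qed.

Lemma eucl_norm_mulmx_frob (R : realType) (l : nat) (A : 'M[R]_l) (u : 'cV[R]_l) :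
  eucl_norm (A *m u) <= Num.sqrt (frob A) * eucl_norm u.
Proof.
rewrite eucl_norm_le ?mulr_ge0 ?sqrtr_ge0 ?eucl_norm_ge0 //.
rewrite exprMn sqr_sqrtr ?frob_ge0 // mulr_suml; apply: ler_sum => i _.
have -> : (A *m u) i 0 = dot (\col_j A i j) u.
  by rewrite mxE; apply: eq_bigr => j _; rewrite mxE.
have -> : \sum_j A i j ^+ 2 = eucl_norm (\col_j A i j : 'cV[R]_l) ^+ 2.
  by rewrite eucl_norm_sq; apply: eq_bigr => j _; rewrite mxE expr2.
rewrite -expr2 -exprMn -(real_normK (num_real (dot _ _))).
by rewrite ler_pXn2r ?nnegrE ?mulr_ge0 ?eucl_norm_ge0 // dot_le.
Qed.

(** [sup] is meaningful only for a nonempty set bounded above; the Frobenius norm supplies the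
    bound. *)
Lemma opnorm_has_sup (R : realType) (l : nat) (A : 'M[R]_l) :
  has_sup [set eucl_norm (A *m u) | u in [set u : 'cV[R]_l | eucl_norm u <= 1]].
Proof.
split.
  exists (eucl_norm (A *m 0)); exists 0 => //=.
  by rewrite -(scale0r 0) eucl_normZ normr0 mul0r.
exists (Num.sqrt (frob A)) => _ [u /= u1 <-].
apply: le_trans (eucl_norm_mulmx_frob A u) _.
by rewrite ler_piMr ?sqrtr_ge0.
Qed.

Lemma opnorm_ge (R : realType) (l : nat) (A : 'M[R]_l) (u : 'cV[R]_l) :
  eucl_norm u <= 1 -> eucl_norm (A *m u) <= opnorm A.
Proof. by move=> u1; apply: ub_le_sup; [case: (opnorm_has_sup A)|exists u]. Qed.

Lemma opnorm_le (R : realType) (l : nat) (A : 'M[R]_l) (c : R) :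
  (forall u : 'cV[R]_l, eucl_norm u <= 1 -> eucl_norm (A *m u) <= c) -> opnorm A <= c.
Proof.
move=> H; apply: ge_sup; first by case: (opnorm_has_sup A).
by move=> _ [u /= u1 <-]; exact: H.
Qed.

Lemma opnorm_ge0 (R : realType) (l : nat) (A : 'M[R]_l) : 0 <= opnorm A.
Proof.
apply: le_trans (opnorm_ge A (u := 0) _); first exact: eucl_norm_ge0.
by rewrite -(scale0r 0) eucl_normZ normr0 mul0r.
Qed.

Lemma opnorm_mulmx (R : realType) (l : nat) (A : 'M[R]_l) (u : 'cV[R]_l) :
  eucl_norm (A *m u) <= opnorm A * eucl_norm u.
Proof.
have [/eqP/eucl_norm_eq0->|u0] := boolP (eucl_norm u == 0).
  by rewrite mulmx0 -(scale0r 0) !eucl_normZ normr0 !mul0r mulr0.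
have up : 0 < eucl_norm u by rewrite lt_neqAle eq_sym u0 eucl_norm_ge0.
have := @opnorm_ge R l A ((eucl_norm u)^-1 *: u).
rewrite -scalemxAr !eucl_normZ ger0_norm ?invr_ge0 ?eucl_norm_ge0 // mulVf // => /(_ (lexx _)).
by rewrite mulrC ler_pdivrMr.
Qed.

Lemma bil_opnorm (R : realType) (l : nat) (A : 'M[R]_l) (u v : 'cV[R]_l) :
  `|bil A u v| <= opnorm A * (eucl_norm u * eucl_norm v).
Proof.
rewrite bilE; apply: le_trans (dot_le _ _) _.
rewrite mulrCA ler_wpM2l ?eucl_norm_ge0 //; exact: opnorm_mulmx.
Qed.

(** If [A *m v] is nonzero, its normalization taken as [u] makes the form equal to its norm, so a
    one-sided bound suffices. *)
Lemma opnorm_le_bil (R : realType) (l : nat) (A : 'M[R]_l) (c : R) : 0 <= c ->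
  (forall u v : 'cV[R]_l, eucl_norm u <= 1 -> eucl_norm v <= 1 -> bil A u v <= c) ->
  opnorm A <= c.
Proof.
move=> c0 H; apply: opnorm_le => v v1.
have [/eqP-> //|n0] := boolP (eucl_norm (A *m v) == 0).
have := H ((eucl_norm (A *m v))^-1 *: (A *m v)) v.
rewrite bilZl bilE -eucl_norm_sq eucl_normZ ger0_norm ?invr_ge0 ?eucl_norm_ge0 //.
by rewrite mulVf // expr2 mulKf //; apply.
Qed.

(** * Positive semidefinite matrices: entries, trace and norm *)

Lemma psdmx_mxseminorm (R : realType) (l : nat) (A : 'M[R]_l) (u : 'cV[R]_l) :
  psdmx A -> mxseminorm A u ^+ 2 = qform A u.
Proof. by case=> _ A0; rewrite sqr_sqrtr. Qed.

Lemma psdmx_qform_opnorm (R : realType) (l : nat) (A : 'M[R]_l) (u : 'cV[R]_l) :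
  qform A u <= opnorm A * eucl_norm u ^+ 2.
Proof. by rewrite qform_bil expr2; exact: ler_normlW (bil_opnorm _ _ _). Qed.

Lemma bil_delta (R : realType) (l : nat) (A : 'M[R]_l) (i j : 'I_l) :
  bil A (delta_mx i 0) (delta_mx j 0) = A i j.
Proof.
rewrite /bil (bigD1 i) //= [X in _ + X]big1 ?addr0; last first.
  by move=> k ki; apply: big1 => m _; rewrite mxE (negbTE ki) /= mul0r mulr0.
rewrite (bigD1 j) //= [X in _ + X]big1 ?addr0; last first.
  by move=> m mj; rewrite [delta_mx j 0 m 0]mxE (negbTE mj) /= !mulr0.
by rewrite !mxE !eqxx /= !mulr1.
Qed.

Lemma psdmx_diag_ge0 (R : realType) (l : nat) (A : 'M[R]_l) (i : 'I_l) :
  psdmx A -> 0 <= A i i.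
Proof. by case=> _ /(_ (delta_mx i 0)); rewrite qform_bil bil_delta. Qed.

(** The form is nonnegative on the span of two basis vectors; minimizing along the first leaves the
    two by two minor divided by [A i i]. *)
Lemma psdmx_entry (R : realType) (l : nat) (A : 'M[R]_l) (i j : 'I_l) :
  psdmx A -> A i j ^+ 2 <= A i i * A j j.
Proof.
move=> pA; have [At A0] := pA; have ii := psdmx_diag_ge0 i pA.
have ji : A j i = A i j by rewrite -{1}At mxE.
have [i0|i0] := eqVneq (A i i) 0.
  rewrite i0 mul0r.
  have q x : 0 <= 2 * x * A i j + A j j.
    have := A0 (x *: delta_mx i 0 + delta_mx j 0).
    by rewrite qform_bil !(bilDl, bilDr, bilZl, bilZr) !bil_delta ji i0; lra.
  have [->|ij0] := eqVneq (A i j) 0; first by rewrite expr0n.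
  (* With [A i i = 0] the form is affine in [x]; this [x] would give it the value -1. *)
  have := q (- (A j j + 1) / (2 * A i j)).
  have -> : 2 * (- (A j j + 1) / (2 * A i j)) * A i j = - (A j j + 1) by field.
  lra.
have := A0 (- (A i j / A i i) *: delta_mx i 0 + delta_mx j 0).
rewrite qform_bil !(bilDl, bilDr, bilZl, bilZr) !bil_delta ji.
have -> : - (A i j / A i i) * (- (A i j / A i i) * A i i) + - (A i j / A i i) * A i j +
  (- (A i j / A i i) * A i j + A j j) = (A i i * A j j - A i j ^+ 2) / A i i by field.
have ip : 0 < A i i by rewrite lt_neqAle eq_sym i0.
by rewrite pmulr_lge0 ?invr_gt0 // subr_ge0.
Qed.

(** Summing [psdmx_entry] over all entries bounds the Frobenius norm by the trace. It follows that
    the effective rank is at least 1. *)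
Lemma psdmx_opnorm_trace (R : realType) (l : nat) (A : 'M[R]_l) :
  psdmx A -> opnorm A <= \tr A.
Proof.
move=> pA; have t0 : 0 <= \tr A by apply: sumr_ge0 => i _; exact: psdmx_diag_ge0.
apply: opnorm_le => u u1; apply: le_trans (eucl_norm_mulmx_frob A u) _.
rewrite -[leRHS]mulr1 ler_pM ?sqrtr_ge0 ?eucl_norm_ge0 //.
rewrite -(ger0_norm t0) -sqrtr_sqr ler_sqrt ?sqr_ge0 //.
rewrite expr2 {1}/mxtrace mulr_suml; apply: ler_sum => i _.
rewrite mulr_sumr; apply: ler_sum => j _; exact: psdmx_entry.
Qed.

Lemma opnorm_gt0 (R : realType) (l : nat) (A : 'M[R]_l) : A != 0 -> 0 < opnorm A.
Proof.
move=> A0; rewrite lt_neqAle opnorm_ge0 andbT eq_sym.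
apply: contra A0 => /eqP o0; apply/eqP/matrixP => i j; rewrite mxE -(bil_delta A).
by have := bil_opnorm A (delta_mx i 0) (delta_mx j 0); rewrite o0 mul0r normr_le0 => /eqP.
Qed.

(** * Tilted sign vectors *)

Definition sgnb {R : realType} (b : bool) : R := if b then -1 else 1.

(* Density of independent signs with means [x i], with respect to counting measure. *)
Definition tilt {R : realType} {I : finType} (x : I -> R) (w : {ffun I -> bool}) : R :=
  \prod_i ((1 + sgnb (w i) * x i) / 2).

Lemma tilt_ge0 (R : realType) (I : finType) (x : I -> R) (w : {ffun I -> bool}) :
  (forall i, `|x i| <= 1) -> 0 <= tilt x w.
Proof.
move=> x1; apply: prodr_ge0 => i _; have := x1 i; rewrite ler_norml => /andP[a b].
by rewrite /sgnb; case: (w i); lra.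
Qed.

(** Independence of the coordinates: the sum over sign patterns distributes over the product. Mass,
    means and covariances come from special choices of [f]. *)
Lemma tilt_expect_prod (R : realType) (I : finType) (x : I -> R) (f : I -> bool -> R) :
  \sum_w tilt x w * \prod_i f i (w i) =
  \prod_i ((1 + x i) / 2 * f i false + (1 - x i) / 2 * f i true).
Proof.
transitivity (\prod_i \sum_(b : bool) ((1 + sgnb b * x i) / 2 * f i b)).
  by rewrite bigA_distr_bigA; apply: eq_bigr => w _; rewrite /tilt -big_split.
apply: eq_bigr => i _; rewrite big_bool /sgnb /=; ring.
Qed.

Lemma tilt_sum1 (R : realType) (I : finType) (x : I -> R) : \sum_w tilt x w = 1.
Proof.
transitivity (\sum_w tilt x w * \prod_(i : I) 1).
  by apply: eq_bigr => w _; rewrite prodr_const expr1n mulr1.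
rewrite (tilt_expect_prod x (fun _ _ => 1)).
by apply: big1 => i _; field.
Qed.

Lemma tilt_mean (R : realType) (I : finType) (x : I -> R) (i : I) :
  \sum_w tilt x w * sgnb (w i) = x i.
Proof.
pose f (j : I) (b : bool) : R := if j == i then sgnb b else 1.
transitivity (\sum_w tilt x w * \prod_j f j (w j)).
  by apply: eq_bigr => w _; rewrite /f -big_mkcond big_pred1_eq.
rewrite tilt_expect_prod /f (bigD1 i) //= eqxx big1 => [|j /negbTE ->]; last by field.
by rewrite /sgnb /=; field.
Qed.

Lemma tilt_covar (R : realType) (I : finType) (x : I -> R) (i j : I) :
  \sum_w tilt x w * (sgnb (w i) * sgnb (w j)) = x i * x j + (1 - x i ^+ 2) * (i == j)%:R.
Proof.
have [<-|ij] := eqVneq i j.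
  under eq_bigr => w _.
    have -> : sgnb (w i) * sgnb (w i) = 1 :> R by rewrite /sgnb; case: (w i); ring.
    rewrite mulr1; over.
  by rewrite tilt_sum1 /=; ring.
pose f (k : I) (b : bool) : R := if (k == i) || (k == j) then sgnb b else 1.
transitivity (\sum_w tilt x w * \prod_k f k (w k)).
  apply: eq_bigr => w _; rewrite /f -big_mkcond (bigD1 i) /= ?eqxx // (big_pred1 j) //.
  move=> k /=; rewrite andb_orl andbN /=.
  by case: (eqVneq k j) => //= ->; rewrite eq_sym ij.
rewrite tilt_expect_prod /f mulr0 addr0 (bigD1 i) // (bigD1 j) /= 1?eq_sym //.
rewrite !eqxx orbT /= big1 => [|k /andP[/negbTE -> /negbTE ->] /=]; last by field.
by rewrite /sgnb /=; field.
Qed.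

(** Apply [1 + s <= expR s] in each factor; the remaining halves make up the uniform law on
    signs. *)
Lemma tilt_le_expR (R : realType) (I : finType) (x : I -> R) (w : {ffun I -> bool}) :
  (forall i, `|x i| <= 1) ->
  tilt x w <= (2 ^+ #|I|)^-1 * expR (\sum_i sgnb (w i) * x i).
Proof.
move=> x1; rewrite expR_sum -exprVn -prodr_const -big_split /=.
apply: ler_prod => i _; apply/andP; split.
  have := x1 i; rewrite ler_norml => /andP[a b].
  by rewrite /sgnb; case: (w i); lra.
by rewrite mulrC ler_wpM2l // expR_ge1Dx.
Qed.

(** * Jensen's inequality and change of measure *)

Lemma jensen_expR (R : realType) (I : finType) (p f : I -> R) :
  (forall i, 0 <= p i) -> \sum_i p i = 1 ->
  expR (\sum_i p i * f i) <= \sum_i p i * expR (f i).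
Proof.
move=> p0 p1; set m := \sum_i p i * f i.
rewrite -[expR m]mulr1.
(* The deviations [f i - m] average to zero, so the tangent line to the exponential at [m] averages
   to exactly [expR m]. *)
have -> : 1 = \sum_i p i * (1 + (f i - m)).
  under eq_bigr do rewrite mulrDr mulrBr mulr1.
  by rewrite big_split sumrB /= p1 -mulr_suml p1 mul1r subrr addr0.
rewrite mulr_sumr; apply: ler_sum => i _.
rewrite mulrCA ler_wpM2l // -[leRHS](_ : expR m * expR (f i - m) = _); last first.
  by rewrite -expRD; congr expR; ring.
by rewrite ler_wpM2l ?expR_ge0 // expR_ge1Dx.
Qed.

(* Finite form of the Donsker-Varadhan inequality, with the bound [p <= q e^g] on the
   density in place of the relative entropy. *)
Lemma gibbs_le (R : realType) (I : finType) (p q g f : I -> R) :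
  (forall i, 0 <= p i) -> \sum_i p i = 1 -> (forall i, p i <= q i * expR (g i)) ->
  expR (\sum_i p i * f i) <= expR (\sum_i p i * g i) * \sum_i q i * expR (f i).
Proof.
move=> p0 p1 pq.
have -> : \sum_i p i * f i = \sum_i p i * g i + \sum_i p i * (f i - g i).
  by rewrite -big_split; apply: eq_bigr => i _ /=; ring.
rewrite expRD ler_wpM2l ?expR_ge0 //.
apply: le_trans (jensen_expR _ p0 p1) _; apply: ler_sum => i _.
have -> : q i * expR (f i) = q i * expR (g i) * expR (f i - g i).
  by rewrite -mulrA -expRD; congr (_ * expR _); ring.
by rewrite ler_wpM2r ?expR_ge0.
Qed.

(** * Averages of sign vectors with a prescribed mean *)

Section cube.
Context {R : realType} {l N : nat}.
Hypothesis N0 : (0 < N)%N.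

Local Notation cube := {ffun 'I_l * 'I_N -> bool}.

Definition avg (w : cube) : 'cV[R]_l := \col_i (N%:R^-1 * \sum_(a < N) sgnb (w (i, a))).

(** The index [(i, a)] is coordinate [i] of sign vector [a]. The sign means do not depend on [a], so
    the [N] vectors are independent copies. *)
Definition tiltv (u : 'cV[R]_l) (w : cube) : R := tilt (fun p => u p.1 0) w.

Lemma eucl_norm_coord (u : 'cV[R]_l) i : eucl_norm u <= 1 -> `|u i 0| <= 1.
Proof.
move=> u1; rewrite -(@ler_pXn2r _ 2) ?nnegrE // expr1n real_normK ?num_real //.
move: u1; rewrite eucl_norm_le // expr1n => /(le_trans _); apply.
by rewrite /dot (bigD1 i) //= -expr2 lerDl; apply: sumr_ge0 => j _; rewrite -expr2 sqr_ge0.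
Qed.

Lemma tiltv_ge0 u w : eucl_norm u <= 1 -> 0 <= tiltv u w.
Proof. by move=> u1; apply: tilt_ge0 => p; exact: eucl_norm_coord. Qed.

Lemma tiltv_sum1 u : \sum_w tiltv u w = 1.
Proof. exact: tilt_sum1. Qed.

Lemma natrN_neq0 : N%:R != 0 :> R.
Proof. by rewrite pnatr_eq0 -lt0n. Qed.

Lemma tiltv_mean u : \sum_w tiltv u w *: avg w = u.
Proof.
apply/matrixP => i j; rewrite (ord1 j) summxE.
transitivity (\sum_w N%:R^-1 * \sum_(a < N) tiltv u w * sgnb (w (i, a))).
  by apply: eq_bigr => w _; rewrite !mxE mulrCA; congr (_ * _); rewrite mulr_sumr.
rewrite -mulr_sumr exchange_big /=.
under eq_bigr do rewrite tilt_mean /=.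
by rewrite sumr_const card_ord -[u i 0 *+ N]mulr_natl mulKf // natrN_neq0.
Qed.

(** By independence the covariance of [avg] is diagonal, with entries [(1 - u i 0 ^+ 2) / N].
    Applied below to [S], where the trace appears, and to a rank-one matrix, where the form is a
    squared projection. *)
Lemma tiltv_qform u (B : 'M[R]_l) :
  \sum_w tiltv u w * qform B (avg w) =
  qform B u + N%:R^-1 * \sum_i B i i * (1 - u i 0 ^+ 2).
Proof.
have avg2 w i j : avg w i 0 * avg w j 0 =
    N%:R^-1 ^+ 2 * \sum_(a < N) \sum_(b < N) sgnb (w (i, a)) * sgnb (w (j, b)).
  rewrite !mxE expr2 mulrACA; congr (_ * _); rewrite mulr_suml.
  by apply: eq_bigr => a _; rewrite mulr_sumr.
have E i j : \sum_w tiltv u w * (avg w i 0 * avg w j 0) =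
    u i 0 * u j 0 + N%:R^-1 * ((1 - u i 0 ^+ 2) * (i == j)%:R).
  under eq_bigr do rewrite avg2 mulrCA.
  rewrite -mulr_sumr.
  under eq_bigr do rewrite mulr_sumr.
  rewrite exchange_big /=.
  under eq_bigr => a _.
    under eq_bigr do rewrite mulr_sumr.
    rewrite exchange_big /=.
    under eq_bigr do rewrite tilt_covar xpair_eqE /= -mulnb natrM.
    over.
  move=> /=.
  (* Only the [N] pairs with [a = b] carry a variance term. *)
  have -> : \sum_(a < N) \sum_(b < N)
        (u i 0 * u j 0 + (1 - u i 0 ^+ 2) * ((i == j)%:R * (a == b)%:R)) =
      N%:R ^+ 2 * (u i 0 * u j 0) + N%:R * ((1 - u i 0 ^+ 2) * (i == j)%:R).
    transitivity (\sum_(a < N) (N%:R * (u i 0 * u j 0) + (1 - u i 0 ^+ 2) * (i == j)%:R)).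
      apply: eq_bigr => a _; rewrite big_split /= sumr_const card_ord -[_ *+ N]mulr_natl.
      congr (_ + _); rewrite (bigD1 a) //= eqxx big1 => [|b ba]; first by rewrite addr0 mulr1.
      by rewrite [a == b]eq_sym (negbTE ba) !mulr0.
    by rewrite sumr_const card_ord -[_ *+ N]mulr_natl; ring.
  by field; exact: natrN_neq0.
transitivity (\sum_i \sum_j B i j * \sum_w tiltv u w * (avg w i 0 * avg w j 0)).
  transitivity (\sum_w \sum_i \sum_j B i j * (tiltv u w * (avg w i 0 * avg w j 0))).
    apply: eq_bigr => w _; rewrite qform_bil mulr_sumr; apply: eq_bigr => i _.
    by rewrite mulr_sumr; apply: eq_bigr => j _; rewrite mulrCA.
  rewrite exchange_big; apply: eq_bigr => i _ /=; rewrite exchange_big.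
  by apply: eq_bigr => j _ /=; rewrite mulr_sumr.
rewrite qform_bil /bil mulr_sumr -big_split /=; apply: eq_bigr => i _.
under eq_bigr do rewrite E mulrDr.
rewrite big_split /=; congr (_ + _).
rewrite (bigD1 i) //= eqxx big1 => [|j ji]; first by rewrite addr0 mulr1 mulrCA.
by rewrite eq_sym (negbTE ji) !mulr0.
Qed.

Lemma tiltv_le u w : eucl_norm u <= 1 ->
  tiltv u w <= (2 ^+ #|{: 'I_l * 'I_N}|)^-1 * expR (N%:R * dot u (avg w)).
Proof.
move=> u1; apply: le_trans (tilt_le_expR _ _) _; first by move=> p; exact: eucl_norm_coord.
rewrite ler_wpM2l ?invr_ge0 ?exprn_ge0 // ler_expR le_eqVlt; apply/orP; left; apply/eqP.
transitivity (\sum_i \sum_a sgnb (w (i, a)) * u i 0).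
  by rewrite pair_bigA; apply: eq_bigr => -[].
rewrite /dot mulr_sumr.
apply: eq_bigr => i _; rewrite mxE -mulr_suml mulrCA mulVKf ?natrN_neq0 1?mulrC //.
Qed.

(** Since [avg] has mean [u], the left-hand side is [N] times the squared norm of [u]. This is the
    cost of one vector in the change of measure. *)
Lemma tiltv_dot u : eucl_norm u <= 1 ->
  \sum_w tiltv u w * (N%:R * dot u (avg w)) <= N%:R.
Proof.
move=> u1; rewrite -[leRHS]mulr1.
under eq_bigr do rewrite mulrCA.
rewrite -mulr_sumr ler_wpM2l //.
have -> : \sum_w tiltv u w * dot u (avg w) = dot u (\sum_w tiltv u w *: avg w).
  by rewrite dotE bil_sumr; apply: eq_bigr => w _; rewrite bilZr dotE.
by rewrite tiltv_mean -[1](expr1n _ 2) -eucl_norm_le.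
Qed.

(** [gibbs_le] for the product of the two tilted laws. The double sum on the right is free of [u]
    and [v], so one random event serves all pairs at once. *)
Lemma gibbs_cube (u v : 'cV[R]_l) (h : cube -> cube -> R) :
  eucl_norm u <= 1 -> eucl_norm v <= 1 ->
  expR (\sum_w \sum_z tiltv u w * tiltv v z * h w z) <=
  expR (2 * N%:R) * \sum_w \sum_z (2 ^+ #|{: 'I_l * 'I_N}|)^-1 ^+ 2 * expR (h w z).
Proof.
move=> u1 v1.
pose p (x : cube * cube) := tiltv u x.1 * tiltv v x.2.
pose g (x : cube * cube) := N%:R * dot u (avg x.1) + N%:R * dot v (avg x.2).
rewrite !pair_bigA /=.
have p0 x : 0 <= p x by rewrite mulr_ge0 ?tiltv_ge0.
have p1 : \sum_x p x = 1.
  rewrite /p -(pair_bigA _ (fun w z => tiltv u w * tiltv v z)) /=.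
  under eq_bigr do rewrite -mulr_sumr tiltv_sum1 mulr1.
  exact: tiltv_sum1.
have pq x : p x <= (2 ^+ #|{: 'I_l * 'I_N}|)^-1 ^+ 2 * expR (g x).
  by rewrite expr2 expRD mulrACA ler_pM ?tiltv_ge0 ?tiltv_le.
apply: le_trans (gibbs_le (fun x => h x.1 x.2) p0 p1 pq) _.
rewrite ler_wpM2r //.
  by apply: sumr_ge0 => x _; rewrite mulr_ge0 ?expR_ge0 // exprn_ge0 // invr_ge0 exprn_ge0.
rewrite ler_expR.
have -> : \sum_x p x * g x = \sum_w tiltv u w * (N%:R * dot u (avg w)) +
    \sum_z tiltv v z * (N%:R * dot v (avg z)).
  rewrite /p /g -(pair_bigA _ (fun w z => tiltv u w * tiltv v z *
     (N%:R * dot u (avg w) + N%:R * dot v (avg z)))) /=.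
  transitivity (\sum_w \sum_z (tiltv u w * (N%:R * dot u (avg w)) * tiltv v z +
     tiltv u w * (tiltv v z * (N%:R * dot v (avg z))))).
    by apply: eq_bigr => w _; apply: eq_bigr => z _; ring.
  transitivity (\sum_w (tiltv u w * (N%:R * dot u (avg w)) +
      tiltv u w * \sum_z tiltv v z * (N%:R * dot v (avg z)))).
    by apply: eq_bigr => w _; rewrite big_split /= -!mulr_sumr tiltv_sum1 mulr1.
  by rewrite big_split /= -mulr_suml tiltv_sum1 mul1r.
have := tiltv_dot u1; have := tiltv_dot v1; lra.
Qed.

End cube.

(** * Truncation *)

Section truncation.
Context {R : realType} {l N : nat} (S : 'M[R]_l).
Hypothesis N0 : (0 < N)%N.
Hypothesis psdS : psdmx S.
Hypothesis S0 : 0 < opnorm S.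
Hypothesis trS : \tr S <= N%:R * opnorm S.

Local Notation cube := {ffun 'I_l * 'I_N -> bool}.

Definition good (w : cube) : bool := qform S (avg w) <= 64 * opnorm S.

(** The mean is cut off rather than conditioned: without division by the mass of [G], the parts for
    [good] and its complement add up to [u]. *)
Definition trunc_mean (G : pred cube) (u : 'cV[R]_l) : 'cV[R]_l :=
  \sum_w (tiltv u w * (G w)%:R) *: avg w.

Lemma trunc_meanD (u : 'cV[R]_l) : trunc_mean good u + trunc_mean (predC good) u = u.
Proof.
rewrite -[RHS](tiltv_mean N0) -big_split; apply: eq_bigr => w _ /=.
by rewrite -scalerDl -mulrDr; case: (good w); rewrite ?addr0 ?add0r mulr1.
Qed.

(** Markov's inequality: the form has mean at most [opnorm S + \tr S / N], hence at most
    [2 * opnorm S], and 2/64 = 1/32. *)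
Lemma tiltv_bad (u : 'cV[R]_l) : eucl_norm u <= 1 -> \sum_w tiltv u w * (~~ good w)%:R <= 32^-1.
Proof.
move=> u1; have s64 : 0 < 64 * opnorm S by rewrite mulr_gt0.
apply: (@le_trans _ _ ((64 * opnorm S)^-1 * \sum_w tiltv u w * qform S (avg w))).
  rewrite mulr_sumr; apply: ler_sum => w _; rewrite mulrCA ler_wpM2l ?tiltv_ge0 //.
  rewrite mulrC ler_pdivlMr // /good -ltNge; case: ltP => h; first by rewrite mul1r ltW.
  by rewrite mul0r; case: psdS => _; apply.
rewrite tiltv_qform // mulrC ler_pdivrMr //.
have h1 : qform S u <= opnorm S.
  apply: le_trans (psdmx_qform_opnorm _ _) _.
  by rewrite ler_piMr ?exprn_ile1 ?eucl_norm_ge0 ?opnorm_ge0.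
have h2 : \sum_i S i i * (1 - u i 0 ^+ 2) <= \tr S.
  apply: ler_sum => i _; rewrite ler_piMr ?psdmx_diag_ge0 //.
  by have := sqr_ge0 (u i 0); lra.
have h3 : N%:R^-1 * \sum_i S i i * (1 - u i 0 ^+ 2) <= opnorm S.
  by rewrite mulrC ler_pdivrMr ?ltr0n // mulrC (le_trans h2).
lra.
Qed.

(** The squared norm of [z] is the mean of [dot z (avg w)] over the bad patterns. It is at most half
    of itself plus the bad mass 1/32, hence at most 1/16. *)
Lemma trunc_mean_bad (u : 'cV[R]_l) : eucl_norm u <= 1 -> eucl_norm (trunc_mean (predC good) u) <= 4^-1.
Proof.
move=> u1; set z := trunc_mean _ u.
rewrite eucl_norm_le ?invr_ge0 //.
have h1 : \sum_(w : cube) tiltv u w * dot z (avg w) ^+ 2 <= 2 * dot z z.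
  (* The squared projection is the form of a rank-one matrix whose trace is [dot z z], which makes
     [tiltv_qform] applicable. *)
  have B (w : cube) : dot z (avg w) ^+ 2 = qform (z *m z^T) (avg w).
    rewrite qform_bil expr2 /dot mulr_suml; apply: eq_bigr => i _.
    rewrite mulr_sumr; apply: eq_bigr => j _.
    by rewrite [in RHS]mxE big_ord1 !mxE; ring.
  have -> : \sum_(w : cube) tiltv u w * dot z (avg w) ^+ 2 =
      \sum_(w : cube) tiltv u w * qform (z *m z^T) (avg w).
    by apply: eq_bigr => w _; rewrite B.
  rewrite tiltv_qform //.
  have -> : qform (z *m z^T) u = dot z u ^+ 2.
    rewrite qform_bil expr2 /dot mulr_suml; apply: eq_bigr => i _.
    rewrite mulr_sumr; apply: eq_bigr => j _.
    by rewrite mxE big_ord1 !mxE; ring.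
  have c1 : dot z u ^+ 2 <= dot z z.
    rewrite -(real_normK (num_real _)) -eucl_norm_sq ler_pXn2r ?nnegrE ?eucl_norm_ge0 //.
    by apply: le_trans (dot_le _ _) _; rewrite ler_piMr ?eucl_norm_ge0.
  have c2 : \sum_i (z *m z^T) i i * (1 - u i 0 ^+ 2) <= dot z z.
    apply: ler_sum => i _; rewrite mxE big_ord1 mxE ler_piMr -?expr2 ?sqr_ge0 //.
    by have := sqr_ge0 (u i 0); lra.
  have c3 : N%:R^-1 * \sum_i (z *m z^T) i i * (1 - u i 0 ^+ 2) <= dot z z.
    rewrite mulrC ler_pdivrMr ?ltr0n //; apply: le_trans c2 _.
    by rewrite ler_peMr ?dot_ge0 // ler1n.
  lra.
(* [x 1_B <= x^2 / 4 + 1_B] *)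
have h2 : dot z z <= 4^-1 * (\sum_(w : cube) tiltv u w * dot z (avg w) ^+ 2) +
    \sum_w tiltv u w * (~~ good w)%:R.
  rewrite {2}/z /trunc_mean dotE bil_sumr mulr_sumr -big_split /=; apply: ler_sum => w _.
  rewrite bilZr -dotE -mulrA [4^-1 * _]mulrCA -mulrDr ler_wpM2l ?tiltv_ge0 //.
  case: (good w) => /=; first by rewrite mul0r addr0 mulr_ge0 ?invr_ge0 // sqr_ge0.
  rewrite mul1r; have := sqr_ge0 (dot z (avg w) / 2 - 1).
  have -> : (dot z (avg w) / 2 - 1) ^+ 2 = 4^-1 * dot z (avg w) ^+ 2 + 1 - dot z (avg w) by field.
  lra.
have := tiltv_bad u1; lra.
Qed.

Lemma opnorm_le_truncated (A : 'M[R]_l) (c : R) : 0 <= c ->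
  (forall u v : 'cV[R]_l, eucl_norm u <= 1 -> eucl_norm v <= 1 ->
    \sum_w \sum_z tiltv u w * tiltv v z *
      ((good w && good z)%:R * bil A (avg w) (avg z)) <= c) ->
  opnorm A <= 16 / 7 * c.
Proof.
move=> c0 H.
(* 9/16 is 5/4 times 1/4, for the cut-off mean of [u] against the bad part of [v], plus 1/4, for the
   bad part of [u] against [v]. *)
suff : opnorm A <= c + 9 / 16 * opnorm A by lra.
apply: opnorm_le_bil => [|u v u1 v1].
  by rewrite addr_ge0 // mulr_ge0 ?opnorm_ge0.
set a := trunc_mean good; set b := trunc_mean (predC good).
have main : bil A (a u) (a v) <= c.
  apply: le_trans (H u v u1 v1); rewrite le_eqVlt; apply/orP; left; apply/eqP.
  rewrite bil_suml; apply: eq_bigr => w _; rewrite bil_sumr; apply: eq_bigr => z _.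
  by rewrite bilZl bilZr -mulnb natrM; ring.
have -> : bil A u v = bil A (a u) (a v) + bil A (a u) (b v) + bil A (b u) v.
  by rewrite -bilDr trunc_meanD -bilDl trunc_meanD.
have bu := trunc_mean_bad u1; have bv := trunc_mean_bad v1.
have au : eucl_norm (a u) <= 5 / 4.
  have -> : a u = u + (-1) *: b u by rewrite -{2}(trunc_meanD u) scaleN1r addrK.
  apply: le_trans (eucl_normD _ _) _.
  by rewrite eucl_normZ normrN1 mul1r /b; lra.
have oA := opnorm_ge0 A.
have e1 : bil A (a u) (b v) <= 5 / 16 * opnorm A.
  apply: le_trans (ler_normlW (bil_opnorm _ _ _)) _.
  rewrite mulrC ler_wpM2r //.
  have -> : 5 / 16 = 5 / 4 * 4^-1 :> R by field.
  by rewrite ler_pM ?eucl_norm_ge0.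
have e2 : bil A (b u) v <= 4^-1 * opnorm A.
  apply: le_trans (ler_normlW (bil_opnorm _ _ _)) _.
  rewrite mulrC ler_wpM2r // -[leRHS]mulr1.
  by rewrite ler_pM ?eucl_norm_ge0.
lra.
Qed.

End truncation.

(** * Products of independent variables *)

Section independence.
Context d d' (T : measurableType d) (T' : measurableType d') (R : realType).
Context (P : probability T R) (I : finType) (X : I -> {RV P >-> T'}).
Hypothesis indX : mutually_independent X.

Import HBNNSimple.

Lemma measurable_fun_comp_RV (Y : {RV P >-> T'}) (g : T' -> R) :
  measurable_fun setT g -> measurable_fun setT (fun w => g (Y w)).
Proof. by move=> mg; exact: (measurableT_comp mg (measurable_funPT Y)). Qed.

(** A product of indicators is the indicator of an intersection, whose probability factors by
    independence over the whole index set. *)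
Lemma integral_prod_indic (B : I -> set T') : (forall i, measurable (B i)) ->
  (\int[P]_w (\prod_i \1_(B i) (X i w))%:E = (\prod_i fine (P (X i @^-1` B i)))%:E)%E.
Proof.
move=> mB; have mX i : measurable (X i @^-1` B i).
  by rewrite -[_ @^-1` _]setTI; exact: measurable_funPT.
transitivity (\int[P]_w (\1_(\bigcap_(i in [set` [set: I]%SET]) (X i @^-1` B i)) w)%:E)%E.
  apply: eq_integral => w _; congr EFin; rewrite indicE.
  have [H|H] := pselect ((\bigcap_(i in [set` [set: I]%SET]) (X i @^-1` B i)) w).
    rewrite mem_set //.
    by rewrite big1 // => i _; rewrite indicE mem_set //; apply: H; rewrite /= inE.
  have [i Hi] : exists i, ~ B i (X i w).
    by apply/existsNP => H'; apply: H => i _; exact: H'.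
  by rewrite (memNset H) (bigD1 i) //= indicE memNset // mul0r.
rewrite integral_indic //; last first.
  by apply: fin_bigcap_measurable.
rewrite setIT; apply: (etrans (@indX [set: I]%SET B (fun i _ => mB i))).
rewrite -prodEFin.
by rewrite big_mkcond /=; apply: eq_bigr => i _; rewrite inE fineK // fin_num_measure.
Qed.

Lemma integral_prod_nnsfun (h : I -> {nnsfun T' >-> R}) :
  (\int[P]_w (\prod_i h i (X i w))%:E = \prod_i \int[P]_w (h i (X i w))%:E)%E.
Proof.
(* A finite set of values common to all [h i], so that the product of sums expands over functions
   from [I] to this set. *)
have finF : finite_set (\bigcup_(i in [set: I]) range (h i)).
  by apply: bigcup_finite => // i _; exact: fimfunP.
pose F := fset_set (\bigcup_(i in [set: I]) range (h i)).
have FE i x : h i x \in F by rewrite in_fset_set //; apply: mem_set; exists i => //; exists x.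
have hE i x : h i x = \sum_(y : F) fsval y * \1_(h i @^-1` [set fsval y]) x.
  rewrite (bigD1 [` FE i x]%fset) //= indicE mem_set // mulr1 big1 ?addr0 // => y yx.
  rewrite indicE memNset ?mulr0 //= => e; case/eqP: yx; exact/val_inj.
have mh i (y : R) : measurable (h i @^-1` [set y]) by exact: measurable_sfunP.
have mhX i (y : R) : measurable (X i @^-1` (h i @^-1` [set y])).
  by rewrite -[_ @^-1` _]setTI; exact: measurable_funPT.
have mI i (y : R) : measurable_fun setT (fun w => \1_(h i @^-1` [set y]) (X i w) : R).
  by apply: measurable_fun_comp_RV; exact: measurable_indic.
have F0 (y : F) : 0 <= fsval y.
  have := fsvalP y; rewrite in_fset_set // => /set_mem[i _ [x _ <-]]; exact: fun_ge0.
have intE i : (\int[P]_w (h i (X i w))%:E =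
    (\sum_(y : F) fsval y * fine (P (X i @^-1` (h i @^-1` [set fsval y]))))%:E)%E.
  transitivity (\int[P]_w (\sum_(y : F) (fsval y)%:E * (\1_(h i @^-1` [set fsval y]) (X i w))%:E))%E.
    by apply: eq_integral => w _; rewrite hE -sumEFin; under [RHS]eq_bigr do rewrite -EFinM.
  rewrite ge0_integral_sum //; last 2 first.
  - move=> y; apply/measurable_EFinP; apply: measurable_funM => //.
  - by move=> y w _; rewrite -EFinM lee_fin mulr_ge0.
  rewrite -sumEFin; apply: eq_bigr => y _.
  rewrite ge0_integralZl_EFin //; last exact/measurable_EFinP.
  rewrite EFinM fineK ?fin_num_measure //; congr (_ * _)%E.
  transitivity (\int[P]_w (\1_(X i @^-1` (h i @^-1` [set fsval y])) w)%:E)%E => //.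
  by rewrite integral_indic // setIT.
under [RHS]eq_bigr do rewrite intE.
rewrite prodEFin.
rewrite bigA_distr_bigA -sumEFin /=.
transitivity (\int[P]_w (\sum_(f : {ffun I -> F}) (\prod_i fsval (f i))%:E *
    (\prod_i \1_(h i @^-1` [set fsval (f i)]) (X i w))%:E))%E.
  apply: eq_integral => w _; under eq_bigr do rewrite hE.
  rewrite bigA_distr_bigA -sumEFin; apply: eq_bigr => f _.
  by rewrite -EFinM big_split.
have p0 (f : {ffun I -> F}) : 0 <= \prod_i fsval (f i) by exact: prodr_ge0.
have mP (f : {ffun I -> F}) :
   measurable_fun setT (fun w => (\prod_i \1_(h i @^-1` [set fsval (f i)]) (X i w) : R)).
  by apply: measurable_prod => i _.
have i0 (f : {ffun I -> F}) w : 0 <= (\prod_i \1_(h i @^-1` [set fsval (f i)]) (X i w) : R).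
  by apply: prodr_ge0 => i _; rewrite indicE.
rewrite ge0_integral_sum //; last 2 first.
- by move=> f; apply/measurable_EFinP; apply: measurable_funM.
- by move=> f w _; rewrite -EFinM lee_fin mulr_ge0.
apply: eq_bigr => f _; rewrite ge0_integralZl_EFin //; last 2 first.
- by move=> w _; rewrite lee_fin.
- exact/measurable_EFinP.
by rewrite (integral_prod_indic (B := fun i => h i @^-1` [set fsval (f i)])) // -EFinM big_split.
Qed.

(** Simple functions increasing to each [g i], and monotone convergence. The real bounds [c i] avoid
    products of possibly infinite integrals. *)
Lemma integral_prod_le (g : I -> T' -> R) (c : I -> R) :
  (forall i, measurable_fun setT (g i)) -> (forall i x, 0 <= g i x) ->
  (forall i, (\int[P]_w (g i (X i w))%:E <= (c i)%:E)%E) ->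
  (\int[P]_w (\prod_i g i (X i w))%:E <= (\prod_i c i)%:E)%E.
Proof.
move=> mg g0 gc.
have mEg i : measurable_fun setT (EFin \o g i) by exact/measurable_EFinP.
pose h i n := nnsfun_approx (@measurableT _ T') (mEg i) n.
have hg i x : h i n x @[n --> \oo] --> g i x.
  have g0' y : [set: T'] y -> (0 <= (EFin \o g i) y)%E by rewrite lee_fin.
  by have /fine_cvgP[_] := cvg_nnsfun_approx (@measurableT _ T') (mEg i) g0' (Logic.I : setT x).
have hnd i x : {homo (fun n => h i n x) : m n / (m <= n)%N >-> m <= n}.
  by move=> m n mn; apply/lefP/nd_nnsfun_approx.
have h_le i n x : h i n x <= g i x.
  by rewrite -(cvg_lim _ (hg i x)) //; apply: nondecreasing_cvgn_le; [exact: hnd|exact: cvgP (hg i x)].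
have mh i n : measurable_fun setT (h i n) by exact: measurable_funPT.
have -> : (\int[P]_w (\prod_i g i (X i w))%:E = limn (fun n => \int[P]_w (\prod_i h i n (X i w))%:E))%E.
  rewrite -monotone_convergence //.
  - apply: eq_integral => w _; apply/esym/cvg_lim => //; apply: cvg_EFin; first exact: nearW.
    apply: cvg_big => [|i _]; last exact: hg.
    by move=> z; apply: cvgM; [exact: cvg_fst|exact: cvg_snd].
  - move=> n; apply/measurable_EFinP; apply: measurable_prod => i _; exact: measurable_fun_comp_RV.
  - by move=> n w _; rewrite lee_fin; apply: prodr_ge0 => i _; exact: fun_ge0.
  - move=> w _ m n mn; rewrite lee_fin; apply: ler_prod => i _.
    by rewrite fun_ge0 hnd.
apply: lime_le.
  apply: ereal_nondecreasing_is_cvgn => m n mn; apply: ge0_le_integral => //.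
  - by move=> w _; rewrite lee_fin; apply: prodr_ge0 => i _; exact: fun_ge0.
  - apply/measurable_EFinP; apply: measurable_prod => i _; exact: measurable_fun_comp_RV.
  - apply/measurable_EFinP; apply: measurable_prod => i _; exact: measurable_fun_comp_RV.
  - by move=> w _; rewrite lee_fin; apply: ler_prod => i _; rewrite fun_ge0 hnd.
apply: nearW => n; rewrite integral_prod_nnsfun.
rewrite -prodEFin.
have : forall i, (0 <= \int[P]_w (h i n (X i w))%:E <= (c i)%:E)%E.
  move=> i; apply/andP; split; first by apply: integral_ge0 => w _; rewrite lee_fin fun_ge0.
  apply: le_trans (gc i); apply: ge0_le_integral => //.
  - by move=> w _; rewrite lee_fin fun_ge0.
  - by apply/measurable_EFinP; exact: measurable_fun_comp_RV.
  - by apply/measurable_EFinP; exact: measurable_fun_comp_RV.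
  - by move=> w _; rewrite lee_fin h_le.
move=> H.
(* Nonnegativity is carried through the induction, as multiplying the inequalities requires it. *)
suff : (0 <= \prod_i \int[P]_w (h i n (X i w))%:E <= \prod_i (c i)%:E)%E by case/andP.
elim/big_ind2 : _ => [|x1 x2 y1 y2 /andP[a b] /andP[a' b']|i _]; last exact: H.
  by rewrite lee_fin ler01 lexx.
by rewrite mule_ge0 // lee_pmul.
Qed.

End independence.

(** * Moment generating functions *)

(* The exponential series without its first two terms. *)
Definition exp_tail2 {R : realType} (s : R) : R := expR s - 1 - s.

Definition exp_tail2_series {R : realType} (s : R) (n : nat) : R :=
  \sum_(k < n) s ^+ k.+2 / k.+2`!%:R.

Lemma exp_tail2_cvg (R : realType) (s : R) :
  exp_tail2_series s n @[n --> \oo] --> exp_tail2 s.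
Proof.
have -> : exp_tail2_series s = (fun n => series (exp_coeff s) (n + 2)%N - 1 - s).
  apply/funext => n; rewrite /series /= big_mkord addnC big_ord_recl big_ord_recl /=.
  rewrite /exp_tail2_series [X in _ = 1 * 1^-1 + (_ + X) - 1 - s](_ : _ =
    \sum_(k < n) s ^+ k.+2 / k.+2`!%:R); last by apply: eq_bigr.
  have -> : exp_coeff s (bump 0 0) = s by rewrite /exp_coeff /bump /= expr1 divr1.
  by rewrite divr1; ring.
apply: cvgB; last exact: cvg_cst.
apply: cvgB; last exact: cvg_cst.
by rewrite (cvg_shiftn 2 (series (exp_coeff s))); exact: is_cvg_series_exp_coeff.
Qed.

Lemma exp_tail2_series_nd (R : realType) (s : R) : 0 <= s ->
  {homo exp_tail2_series s : m n / (m <= n)%N >-> m <= n}.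
Proof.
move=> s0 m n mn; rewrite /exp_tail2_series -(subnKC mn) big_split_ord /= lerDl.
by apply: sumr_ge0 => k _; rewrite divr_ge0 // exprn_ge0.
Qed.

Lemma exp_tail2_series_le (R : realType) (s : R) n : 0 <= s ->
  exp_tail2_series s n <= exp_tail2 s.
Proof.
move=> s0; rewrite -(cvg_lim _ (@exp_tail2_cvg R s)) //.
by apply: nondecreasing_cvgn_le; [exact: exp_tail2_series_nd|exact: cvgP (@exp_tail2_cvg R s)].
Qed.

Lemma exp_tail2_ge0 (R : realType) (s : R) : 0 <= exp_tail2 s.
Proof. by have := expR_ge1Dx s; rewrite /exp_tail2; lra. Qed.

(** For negative [s] this amounts to [sinh z >= z] at [z = - s]. *)
Lemma exp_tail2_le_norm (R : realType) (s : R) : exp_tail2 s <= exp_tail2 `|s|.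
Proof.
have [s0|s0] := leP 0 s; first by rewrite ger0_norm.
rewrite ltr0_norm //.
suff sinh (z : R) : 0 <= z -> z *+ 2 <= expR z - expR (- z).
  by have := sinh (- s); rewrite opprK /exp_tail2; lra.
move=> z0; have := exp_tail2_series_le 1 z0.
rewrite /exp_tail2_series big_ord1 /= => h.
have e1 : 1 + z + z ^+ 2 / 2 <= expR z.
  by move: h; rewrite /exp_tail2 (_ : 2`!%:R = 2) //; lra.
have d0 : 0 < 1 + z + z ^+ 2 / 2 by have := sqr_ge0 z; lra.
have e2 : expR (- z) <= (1 + z + z ^+ 2 / 2)^-1.
  by rewrite expRN lef_pV2 ?posrE ?expR_gt0.
(* The two quadratics multiply to [1 + z ^+ 4 / 4], which is at least 1. *)
have e3 : (1 + z + z ^+ 2 / 2)^-1 <= 1 - z + z ^+ 2 / 2.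
  rewrite -div1r ler_pdivrMr //.
  have -> : (1 - z + z ^+ 2 / 2) * (1 + z + z ^+ 2 / 2) = 1 + (z ^+ 2) ^+ 2 / 4 by field.
  by have := sqr_ge0 (z ^+ 2); lra.
lra.
Qed.

(** [exp_tail2] increases on the nonnegative reals, which handles the passage from [x] to the
    midpoint. Its convexity there is the arithmetic-geometric mean inequality for [expR s] and
    [expR t]. *)
Lemma exp_tail2_half (R : realType) (s t x : R) : 0 <= x -> x <= (s + t) / 2 ->
  exp_tail2 x <= (exp_tail2 s + exp_tail2 t) / 2.
Proof.
move=> x0 xst; apply: (@le_trans _ _ (exp_tail2 ((s + t) / 2))).
  rewrite /exp_tail2; set m := (s + t) / 2 in xst *.
  have e : expR m = expR x * expR (m - x) by rewrite -expRD addrC subrK.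
  have h1 := expR_ge1Dx (m - x).
  have h2 : 1 <= expR x by apply: le_trans (expR_ge1Dx x); lra.
  rewrite e; nra.
rewrite /exp_tail2.
have es : expR s = expR (s / 2) ^+ 2 by rewrite -expRM_natl; congr expR; field.
have et : expR t = expR (t / 2) ^+ 2 by rewrite -expRM_natl; congr expR; field.
have est : expR ((s + t) / 2) = expR (s / 2) * expR (t / 2).
  by rewrite -expRD; congr expR; field.
rewrite es et est; have := sqr_ge0 (expR (s / 2) - expR (t / 2)); nra.
Qed.

(** The left-hand side is a single term of the exponential series at [k]. This turns moments growing
    like [k ^+ k] into a geometric series. *)
Lemma exprn_div_fact_le (R : realType) (k : nat) : (0 < k)%N -> k%:R ^+ k / k`!%:R <= expR 1 ^+ k :> R.
Proof.
case: k => // k _; have := @expR_ge1Dxn R k.+1%:R k (ler0n _ _).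
rewrite -(expRM_natl k.+1) mulr1; lra.
Qed.

Lemma geometric_tail2_le (R : realType) (y : R) n : 0 <= y -> y <= 2^-1 ->
  \sum_(k < n) y ^+ k.+2 <= 2 * y ^+ 2.
Proof.
move=> y0 y2; under eq_bigr do rewrite -addn2 exprD.
rewrite -mulr_suml ler_wpM2r ?sqr_ge0 //.
have := subrX1 y n; have yn : 0 <= y ^+ n by exact: exprn_ge0.
have S0 : 0 <= \sum_(i < n) y ^+ i by apply: sumr_ge0 => i _; exact: exprn_ge0.
nra.
Qed.

Lemma measurable_exp_tail2 d (T : measurableType d) (R : realType) (f : T -> R) :
  measurable_fun setT f -> measurable_fun setT (fun x => exp_tail2 (f x)).
Proof.
move=> mf; rewrite /exp_tail2; apply: measurable_funB => //.
by apply: measurable_funB => //; exact: measurableT_comp.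
Qed.

Section mgf.
Context d (T : measurableType d) (R : realType) (P : probability T R).

(** The series is integrated term by term, and the term of degree [k] is at most
    [(expR 1 * lam * M) ^+ k]. Starting at degree two with ratio at most 1/2, the sum is at most
    twice the square. *)
Lemma integral_exp_tail2 (a : T -> R) (lam M : R) :
  measurable_fun setT a -> (forall x, 0 <= a x) -> 0 <= lam -> 0 <= M ->
  (forall k : nat, (0 < k)%N -> (\int[P]_x (a x ^+ k)%:E <= ((k%:R * M) ^+ k)%:E)%E) ->
  expR 1 * lam * M <= 2^-1 ->
  (\int[P]_x (exp_tail2 (lam * a x))%:E <= (2 * (expR 1 * lam * M) ^+ 2)%:E)%E.
Proof.
move=> ma a0 l0 M0 mom y2; set y := expR 1 * lam * M.
have y0 : 0 <= y by rewrite !mulr_ge0 ?expR_ge0.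
have la0 x : 0 <= lam * a x by rewrite mulr_ge0.
have mp k : measurable_fun setT (fun x => (lam * a x) ^+ k).
  by apply: measurable_funX; exact: measurable_funM.
have mt k : measurable_fun setT (fun x => (lam * a x) ^+ k.+2 / k.+2`!%:R).
  exact: measurable_funM.
have t0 k x : 0 <= (lam * a x) ^+ k.+2 / k.+2`!%:R by rewrite divr_ge0 ?exprn_ge0.
have ms n : measurable_fun setT (fun x => exp_tail2_series (lam * a x) n).
  exact: measurable_sum.
have s0 n x : 0 <= exp_tail2_series (lam * a x) n by apply: sumr_ge0 => k _.
have -> : (\int[P]_x (exp_tail2 (lam * a x))%:E =
    limn (fun n => \int[P]_x (exp_tail2_series (lam * a x) n)%:E))%E.
  rewrite -monotone_convergence //.
  - apply: eq_integral => x _; apply/esym/cvg_lim => //; apply: cvg_EFin; first exact: nearW.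
    exact: exp_tail2_cvg.
  - by move=> n; exact/measurable_EFinP.
  - by move=> n x _; rewrite lee_fin.
  - by move=> x _ m n mn; rewrite lee_fin exp_tail2_series_nd.
apply: lime_le.
  apply: ereal_nondecreasing_is_cvgn => m n mn; apply: ge0_le_integral => //.
  - by move=> x _; rewrite lee_fin.
  - exact/measurable_EFinP.
  - exact/measurable_EFinP.
  - by move=> x _; rewrite lee_fin exp_tail2_series_nd.
apply: nearW => n.
have -> : (\int[P]_x (exp_tail2_series (lam * a x) n)%:E =
  \sum_(k < n) \int[P]_x ((lam * a x) ^+ k.+2 / k.+2`!%:R)%:E)%E.
  rewrite -ge0_integral_sum //.
  - by apply: eq_integral => x _; rewrite -sumEFin.
  - by move=> k; exact/measurable_EFinP.
  - by move=> k x _; rewrite lee_fin.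
apply: (@le_trans _ _ (\sum_(k < n) (y ^+ k.+2)%:E)%E); last first.
  by rewrite sumEFin lee_fin geometric_tail2_le.
apply: lee_sum => k _.
have -> : (\int[P]_x ((lam * a x) ^+ k.+2 / k.+2`!%:R)%:E =
    (lam ^+ k.+2 / k.+2`!%:R)%:E * \int[P]_x (a x ^+ k.+2)%:E)%E.
  rewrite -ge0_integralZl_EFin //.
  - by apply: eq_integral => x _; rewrite -EFinM exprMn mulrAC.
  - by move=> x _; rewrite lee_fin exprn_ge0.
  - by apply/measurable_EFinP; exact: measurable_funX.
  - by rewrite divr_ge0 ?exprn_ge0.
apply: (@le_trans _ _ ((lam ^+ k.+2 / k.+2`!%:R)%:E * ((k.+2%:R * M) ^+ k.+2)%:E)%E).
  by rewrite lee_wpmul2l ?mom // lee_fin divr_ge0 ?exprn_ge0.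
rewrite -EFinM lee_fin.
have -> : lam ^+ k.+2 / k.+2`!%:R * (k.+2%:R * M) ^+ k.+2 =
    (k.+2%:R ^+ k.+2 / k.+2`!%:R) * (lam * M) ^+ k.+2 by rewrite !exprMn; ring.
have -> : y ^+ k.+2 = expR 1 ^+ k.+2 * (lam * M) ^+ k.+2 by rewrite /y -mulrA exprMn.
rewrite ler_wpM2r ?exprn_div_fact_le // exprn_ge0 //.
by rewrite mulr_ge0.
Qed.

(** The linear term of [expR (lam * X x)] is integrated exactly and cancels with the centring. Only
    the remainder is dominated, through [a] and [b], which makes the exponent quadratic in [lam]. *)
Lemma mgf_le (X a b : T -> R) (lam M m : R) :
  P.-integrable setT (EFin \o X) -> (\int[P]_x (X x)%:E = m%:E)%E ->
  measurable_fun setT a -> measurable_fun setT b ->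
  (forall x, 0 <= a x) -> (forall x, 0 <= b x) -> 0 <= lam -> 0 <= M ->
  {ae P, forall x, `|X x| <= (a x + b x) / 2} ->
  (forall k : nat, (0 < k)%N -> (\int[P]_x (a x ^+ k)%:E <= ((k%:R * M) ^+ k)%:E)%E) ->
  (forall k : nat, (0 < k)%N -> (\int[P]_x (b x ^+ k)%:E <= ((k%:R * M) ^+ k)%:E)%E) ->
  expR 1 * lam * M <= 2^-1 ->
  (\int[P]_x (expR (lam * (X x - m)))%:E <= (expR (2 * (expR 1 * lam * M) ^+ 2))%:E)%E.
Proof.
move=> iX EX ma mb a0 b0 l0 M0 Xab moma momb y2.
have Ta := integral_exp_tail2 ma a0 l0 M0 moma y2.
have Tb := integral_exp_tail2 mb b0 l0 M0 momb y2.
set y := expR 1 * lam * M in Ta Tb y2 *.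
have mX : measurable_fun setT X by move/integrableP: iX => [/measurable_EFinP].
have mla : measurable_fun setT (fun x => exp_tail2 (lam * a x)).
  by apply: measurable_exp_tail2; exact: measurable_funM.
have mlb : measurable_fun setT (fun x => exp_tail2 (lam * b x)).
  by apply: measurable_exp_tail2; exact: measurable_funM.
pose Y x := 2^-1 * exp_tail2 (lam * a x) + 2^-1 * exp_tail2 (lam * b x) + 1.
have Y0 x : 0 <= Y x by rewrite !addr_ge0 ?mulr_ge0 ?exp_tail2_ge0.
have mY : measurable_fun setT Y.
  apply: measurable_funD => //; apply: measurable_funD; exact: measurable_funM.
have EY : (\int[P]_x (Y x)%:E <= (1 + 2 * y ^+ 2)%:E)%E.
  rewrite /Y; under eq_integral do rewrite !EFinD !EFinM.
  rewrite ge0_integralD //=; last 2 first.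
  - by move=> x _; rewrite adde_ge0 // mule_ge0 // lee_fin exp_tail2_ge0.
  - by apply: emeasurable_funD; apply/measurable_EFinP; exact: measurable_funM.
  rewrite ge0_integralD //=; last 4 first.
  - by move=> x _; rewrite mule_ge0 // lee_fin exp_tail2_ge0.
  - by apply/measurable_EFinP; exact: measurable_funM.
  - by move=> x _; rewrite mule_ge0 // lee_fin exp_tail2_ge0.
  - by apply/measurable_EFinP; exact: measurable_funM.
  rewrite !ge0_integralZl_EFin //=; last 4 first.
  - by move=> x _; rewrite lee_fin exp_tail2_ge0.
  - exact/measurable_EFinP.
  - by move=> x _; rewrite lee_fin exp_tail2_ge0.
  - exact/measurable_EFinP.
  have -> : (\int[P]__ 1 = 1)%E by rewrite integral_cst // mul1e; exact: probability_setT.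
  have -> : (1 + 2 * y ^+ 2 = 2^-1 * (2 * y ^+ 2) + 2^-1 * (2 * y ^+ 2) + 1) by field.
  rewrite !EFinD !EFinM leeD // leeD //; apply: lee_wpmul2l; by rewrite ?lee_fin // -EFinM.
have iY : P.-integrable setT (EFin \o Y).
  apply/integrableP; split; first exact/measurable_EFinP.
  under eq_integral do rewrite /= ger0_norm //.
  exact: le_lt_trans EY (ltry _).
pose F x := lam * X x + Y x.
have mF : measurable_fun setT F by apply: measurable_funD => //; exact: measurable_funM.
have aeF : {ae P, forall x, expR (lam * X x) <= F x}.
  apply: filterS Xab => x Xx.
  have -> : expR (lam * X x) = exp_tail2 (lam * X x) + lam * X x + 1.
    by rewrite /exp_tail2; ring.
  suff : exp_tail2 (lam * X x) <= (exp_tail2 (lam * a x) + exp_tail2 (lam * b x)) / 2.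
    by rewrite /F /Y; lra.
  apply: le_trans (exp_tail2_le_norm _) (exp_tail2_half _ _) => //.
  rewrite normrM ger0_norm // -mulrDr -mulrA ler_wpM2l //.
have iF : (\int[P]_x (F x)%:E <= (lam * m + 1 + 2 * y ^+ 2)%:E)%E.
  have iX' := integrableZl measurableT lam iX.
  have -> : (\int[P]_x (F x)%:E =
      \int[P]_x ((EFin \o (fun x => (lam * X x)%R)) \+ (EFin \o Y)) x)%E by [].
  rewrite integralD_EFin //.
  have -> : (\int[P]_x (EFin \o (fun x => (lam * X x)%R)) x = lam%:E * \int[P]_x (X x)%:E)%E.
    by rewrite -integralZl.
  by rewrite EX -addrA EFinD EFinM leeD.
have mexp : measurable_fun setT (fun x => expR (lam * X x)).
  by apply: measurableT_comp => //; exact: measurable_funM.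
have main : (\int[P]_x (expR (lam * X x))%:E <= (lam * m + 1 + 2 * y ^+ 2)%:E)%E.
  apply: le_trans iF.
  (* [F] is known to be nonnegative only almost everywhere, hence the passage to its absolute
     value. *)
  rewrite (@ae_eq_integral _ _ _ P setT (fun x => `|F x|%:E) (EFin \o F)) //; last 3 first.
  - exact/measurable_EFinP.
  - by apply/measurable_EFinP; exact: measurableT_comp.
  - apply: filterS aeF => x Fx _ /=; rewrite ger0_norm //.
    exact: le_trans (expR_ge0 _) Fx.
  apply: ae_ge0_le_integral => //.
  - exact/measurable_EFinP.
  - by apply/measurable_EFinP; exact: measurableT_comp.
  - apply: filterS aeF => x Fx _; rewrite lee_fin; exact: le_trans Fx (ler_norm _).
have -> : (\int[P]_x (expR (lam * (X x - m)))%:E =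
    (expR (- (lam * m)))%:E * \int[P]_x (expR (lam * X x))%:E)%E.
  rewrite -ge0_integralZl_EFin //.
  - by apply: eq_integral => x _; rewrite -EFinM -expRD; congr (expR _)%:E; ring.
  - exact/measurable_EFinP.
apply: (@le_trans _ _ ((expR (- (lam * m)))%:E * (lam * m + 1 + 2 * y ^+ 2)%:E)%E).
  by apply: lee_wpmul2l => //; rewrite lee_fin expR_ge0.
rewrite -EFinM lee_fin.
apply: (@le_trans _ _ (expR (- (lam * m)) * expR (lam * m + 2 * y ^+ 2))).
  by rewrite ler_wpM2l ?expR_ge0 //; apply: le_trans (expR_ge1Dx _); lra.
by rewrite -expRD addKr.
Qed.

End mgf.

(** * Random matrices *)

(** Rational vectors are dense. The hypothesis is homogeneous because a rational approximation of a
    vector of the unit ball may leave the ball. *)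
Lemma opnorm_le_rat (R : realType) (l : nat) (A : 'M[R]_l) (c : R) : 0 <= c ->
  (forall q : 'cV[rat]_l,
     eucl_norm (A *m map_mx ratr q) <= c * eucl_norm (map_mx ratr q)) ->
  opnorm A <= c.
Proof.
move=> c0 H.
apply: opnorm_le => u u1.
suff He (e : R) : 0 < e -> eucl_norm (A *m u) <= c + e by apply/ler_addgt0Pr.
move=> e0.
have K0 : 0 < (c + opnorm A + 1) * (l%:R + 1).
  by rewrite mulr_gt0 // ltr_wpDl // ?addr_ge0 ?opnorm_ge0.
(* Small enough that [(c + opnorm A) * (l%:R * del) <= e]; the added ones keep the denominator
   positive, also for [l = 0]. *)
pose del : R := e / ((c + opnorm A + 1) * (l%:R + 1)).
have del0 : 0 < del by rewrite divr_gt0.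
have qP i : {q : rat | ratr q \in `]u i 0, u i 0 + del[%R}.
  by apply: cid; apply: rat_in_itvoo; rewrite ltrDl.
pose q : 'cV[rat]_l := \col_i sval (qP i).
pose v : 'cV[R]_l := map_mx ratr q.
have uv : eucl_norm (v + (-1) *: u) <= l%:R * del.
  rewrite eucl_norm_le; last by rewrite mulr_ge0 // ltW.
  apply: (@le_trans _ _ (\sum_(i < l) del ^+ 2)).
    apply: ler_sum => i _; rewrite -expr2 /v /q !mxE.
    have := svalP (qP i); rewrite in_itv /= => /andP[a b].
    by rewrite ler_pXn2r ?nnegrE //; lra.
  rewrite sumr_const card_ord -[_ *+ l]mulr_natl [leRHS]exprMn ler_wpM2r ?sqr_ge0 //.
  case: (l) => [|k]; first by rewrite expr0n.
  by rewrite expr2 ler_peMr // ler1n.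
have -> : u = v + (-1) *: (v + (-1) *: u).
  by rewrite scalerDr scalerA mulrN1 opprK scale1r scaleN1r addNKr.
rewrite mulmxDr.
apply: le_trans (eucl_normD _ _) _.
set z := v + (-1) *: u in uv *.
rewrite -scalemxAr eucl_normZ normrN1 mul1r.
have h1 := H q; have h2 := opnorm_mulmx A z.
have h3 : eucl_norm v <= 1 + l%:R * del.
  have -> : v = u + z by rewrite /z scaleN1r addrC subrK.
  by apply: le_trans (eucl_normD _ _) _; exact: lerD.
have h4 : c * eucl_norm v <= c * (1 + l%:R * del) by rewrite ler_wpM2l.
have h5 : opnorm A * eucl_norm z <= opnorm A * (l%:R * del) by rewrite ler_wpM2l ?opnorm_ge0.
have h6 : (c + opnorm A) * (l%:R * del) <= e.
  have -> : (c + opnorm A) * (l%:R * del) =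
      e * ((c + opnorm A) * l%:R / ((c + opnorm A + 1) * (l%:R + 1))) by rewrite /del; ring.
  rewrite ler_piMr //; first exact: ltW.
  rewrite ler_pdivrMr // mul1r.
  by have := opnorm_ge0 A; have : 0 <= l%:R :> R by []; nra.
rewrite -/v in h1; lra.
Qed.

Section entries.
Context d (T : measurableType d) (R : realType) (l : nat).

Lemma measurable_bil (A : T -> 'M[R]_l) (u v : 'cV[R]_l) :
  (forall i j, measurable_fun setT (fun w => A w i j)) ->
  measurable_fun setT (fun w => bil (A w) u v).
Proof.
move=> mA; apply: measurable_sum => i; apply: measurable_sum => j.
exact: measurable_funM.
Qed.

(** By [opnorm_le_rat] the event is a countable intersection over rational vectors; codes that
    decode to no vector contribute the whole space. *)
Lemma measurable_opnorm_le (A : T -> 'M[R]_l) (c : R) : 0 <= c ->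
  (forall i j, measurable_fun setT (fun w => A w i j)) ->
  measurable [set w | opnorm (A w) <= c].
Proof.
move=> c0 mA.
pose F (q : 'cV[rat]_l) :=
  [set w | dot (A w *m map_mx ratr q) (A w *m map_mx ratr q) <= (c * eucl_norm (map_mx ratr q)) ^+ 2].
have -> : [set w | opnorm (A w) <= c] =
    \bigcap_n (if choice.unpickle (n : nat) is Some q then F q else setT).
  apply/seteqP; split => [w /= Ac n _|w /= H].
    case: choice.unpickle => // q; rewrite /F /= -eucl_norm_le ?mulr_ge0 ?eucl_norm_ge0 //.
    by apply: le_trans (opnorm_mulmx _ _) _; rewrite ler_wpM2r ?eucl_norm_ge0.
  apply: opnorm_le_rat => // q; have := H (choice.pickle q) Logic.I.
  by rewrite choice.pickleK /F /= -eucl_norm_le ?mulr_ge0 ?eucl_norm_ge0.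
apply: bigcapT_measurable => n; case: choice.unpickle => // q; rewrite /F.
set x := map_mx ratr q; set b := (_ ^+ 2).
have mf : measurable_fun setT (fun w => dot (A w *m x) (A w *m x)).
  apply: measurable_sum => i.
  under eq_fun do rewrite mxE.
  by apply: measurable_funM; apply: measurable_sum => j; apply: measurable_funM.
rewrite (_ : [set w | _] = [set: T] `&` (fun w => dot (A w *m x) (A w *m x)) @^-1` `]-oo, b]).
  exact: mf.
by rewrite setTI; apply/seteqP; split => w /=; rewrite in_itv.
Qed.

End entries.

Lemma measurable_entry (R : realType) (l : nat) (i j : 'I_l) :
  measurable_fun setT (fun M : borel_mx R l => mx_of M i j).
Proof.
apply: (measurability _ (RGenOInfty.measurableE R)) => _ [_ [x ->] <-].
rewrite setTI; apply: sub_sigma_algebra.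
apply: (@open_comp _ _ (fun M : 'M[R]_l => M i j)).
  by move=> M _; exact: coord_continuous.
exact: rray_open.
Qed.

(** * Mean, moments and exponential moments of a random positive semidefinite matrix *)

Section random_psd.
Context d (T : measurableType d) (R : realType) (P : probability T R) (l : nat).
Context (Z : {RV P >-> borel_mx R l}) (S : 'M[R]_l).
Hypothesis psdZ : {ae P, forall x, psdmx (mx_of (Z x))}.
Hypothesis meanZ : has_mean P (fun x => mx_of (Z x)) S.

Lemma measurable_entry_RV i j : measurable_fun setT (fun x => mx_of (Z x) i j).
Proof. exact: (measurableT_comp (measurable_entry i j) (measurable_funPT Z)). Qed.

Lemma integrable_bil u v : P.-integrable setT (EFin \o (fun x => bil (mx_of (Z x)) u v)).
Proof.
have -> : EFin \o (fun x => bil (mx_of (Z x)) u v) =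
    (fun x => \sum_i \sum_j (u i 0 * v j 0)%:E * (mx_of (Z x) i j)%:E)%E.
  apply/funext => x /=; rewrite -sumEFin; apply: eq_bigr => i _.
  by rewrite -sumEFin; apply: eq_bigr => j _; rewrite -EFinM mulrC.
apply: integrable_sum => // i _; apply: integrable_sum => // j _.
by apply: integrableZl => //; have [] := meanZ i j.
Qed.

Lemma integral_bil u v : (\int[P]_x (bil (mx_of (Z x)) u v)%:E = (bil S u v)%:E)%E.
Proof.
transitivity (\int[P]_x \sum_i \sum_j (u i 0 * v j 0)%:E * (mx_of (Z x) i j)%:E)%E.
  apply: eq_integral => x _ /=; rewrite -sumEFin; apply: eq_bigr => i _.
  by rewrite -sumEFin; apply: eq_bigr => j _; rewrite -EFinM mulrC.
have iZ i j : P.-integrable setT (fun x => (u i 0 * v j 0)%:E * (mx_of (Z x) i j)%:E)%E.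
  by apply: integrableZl => //; have [] := meanZ i j.
rewrite integral_sum //; last by move=> i; exact: integrable_sum.
rewrite -sumEFin; apply: eq_bigr => i _; rewrite integral_sum //.
rewrite -sumEFin; apply: eq_bigr => j _.
rewrite integralZl //; last by have [] := meanZ i j.
by have [_] := meanZ i j; rewrite unlock => ->; rewrite -EFinM mulrC.
Qed.

Lemma psdmx_mean : psdmx S.
Proof.
split.
  apply/matrixP => i j; rewrite mxE; apply: EFin_inj.
  have [_ <-] := meanZ i j; have [_ <-] := meanZ j i; rewrite unlock.
  apply: ae_eq_integral => //.
  - by apply/measurable_EFinP; exact: measurable_entry_RV.
  - by apply/measurable_EFinP; exact: measurable_entry_RV.
  - by apply: filterS psdZ => x [tZ _] _; rewrite -{2}tZ mxE.
move=> u; rewrite qform_bil -lee_fin -integral_bil.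
have mb := measurable_bil u u measurable_entry_RV.
rewrite (@ae_eq_integral _ _ _ P setT (fun x => `|bil (mx_of (Z x)) u u|%:E)) //.
- by apply: integral_ge0 => x _; rewrite lee_fin.
- exact/measurable_EFinP.
- by apply/measurable_EFinP; exact: measurableT_comp.
- by apply: filterS psdZ => x [_ qZ] _ /=; rewrite ger0_norm // -qform_bil.
Qed.

(** The assumption at [p = k], raised to the power [k]: the form in which moments enter the
    exponential series. *)
Lemma moment_le (eta M : R) (u : 'cV[R]_l) :
  (forall p : R, 1 <= p ->
     ('E_P[fun x => (`|qform (mx_of (Z x)) u| `^ p)%R] `^ p^-1
        <= (eta * p * mxseminorm S u ^+ 2)%:E)%E) ->
  eta * mxseminorm S u ^+ 2 <= M -> 0 <= eta ->
  forall k : nat, (0 < k)%N ->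
  (\int[P]_x (`|qform (mx_of (Z x)) u| ^+ k)%:E <= ((k%:R * M) ^+ k)%:E)%E.
Proof.
move=> mom eM eta0 k k0; have := mom k%:R; rewrite ler1n => /(_ k0).
set a := ('E_P[_])%E => H.
have -> : (\int[P]_x (`|qform (mx_of (Z x)) u| ^+ k)%:E)%E = a.
  by rewrite /a unlock; apply: eq_integral => x _; rewrite powR_mulrn.
have a0 : (0 <= a)%E.
  by rewrite /a unlock; apply: integral_ge0 => x _; rewrite lee_fin powR_ge0.
have b0 : 0 <= eta * k%:R * mxseminorm S u ^+ 2 by rewrite mulr_ge0 ?sqr_ge0 // mulr_ge0.
have -> : a = ((a `^ k%:R^-1) `^ k%:R)%E.
  by rewrite -poweRrM mulVf ?poweRe1 // pnatr_eq0 -lt0n.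
apply: (@le_trans _ _ ((eta * k%:R * mxseminorm S u ^+ 2)%:E `^ k%:R)%E).
  apply: gt0_ler_poweR => //; rewrite in_itv /= leey andbT ?poweR_ge0 //.
have kM : 0 <= k%:R * M.
  by rewrite mulr_ge0 //; apply: le_trans eM; rewrite mulr_ge0 ?sqr_ge0.
rewrite poweR_EFin powR_mulrn // lee_fin ler_pXn2r ?nnegrE //.
by rewrite mulrAC [leRHS]mulrC ler_wpM2r.
Qed.

(** [mgf_le] for the bilinear form, which [psdmx_bil_le] dominates by the quadratic forms at [u] and
    [v]. *)
Lemma mgf_bil (eta M lam : R) (u v : 'cV[R]_l) :
  (forall (p : R) (u : 'cV[R]_l), 1 <= p ->
     ('E_P[fun x => (`|qform (mx_of (Z x)) u| `^ p)%R] `^ p^-1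
        <= (eta * p * mxseminorm S u ^+ 2)%:E)%E) ->
  0 <= eta -> 0 <= lam -> eta * qform S u <= M -> eta * qform S v <= M ->
  expR 1 * lam * M <= 2^-1 ->
  (\int[P]_x (expR (lam * (bil (mx_of (Z x)) u v - bil S u v)))%:E <=
    (expR (2 * (expR 1 * lam * M) ^+ 2))%:E)%E.
Proof.
move=> mom eta0 l0 uM vM y2.
have pS := psdmx_mean.
have M0 : 0 <= M by apply: le_trans uM; rewrite mulr_ge0 //; case: pS.
have mq w : measurable_fun setT (fun x => `|qform (mx_of (Z x)) w|).
  apply: measurableT_comp => //; under eq_fun do rewrite qform_bil.
  exact: measurable_bil measurable_entry_RV.
apply: (mgf_le (a := fun x => `|qform (mx_of (Z x)) u|) (b := fun x => `|qform (mx_of (Z x)) v|)) => //.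
- exact: integrable_bil.
- exact: integral_bil.
- apply: filterS psdZ => x pZ; have [_ qZ] := pZ.
  by rewrite (ger0_norm (qZ u)) (ger0_norm (qZ v)); exact: psdmx_bil_le.
- by apply: moment_le eta0 => //; [move=> p; exact: mom|rewrite psdmx_mxseminorm].
- by apply: moment_le eta0 => //; [move=> p; exact: mom|rewrite psdmx_mxseminorm].
Qed.

End random_psd.

(** * The deviation inequality *)

(** The sum is balanced at [y] of order [Num.sqrt q], subject to [y <= 1/2]. Once [Num.sqrt q >= 1]
    the sum is of order [q], and the second entry of the maximum, at least [Num.sqrt q / 2], absorbs
    the extra factor. *)
Lemma rate_le (R : realType) (q : R) : 0 < q ->
  let y := Num.min 1 (Num.sqrt q) / 2 in
  0 < y /\ y <= 2^-1 /\
  2 * q / y + 2 * y <= 10 * (Num.sqrt q * Num.max 1 (Num.sqrt (q / 2))).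
Proof.
move=> q0; set s := Num.sqrt q.
have s0 : 0 < s by rewrite sqrtr_gt0.
have qs : q = s ^+ 2 by rewrite sqr_sqrtr // ltW.
have m1 : 1 <= Num.max 1 (Num.sqrt (q / 2)) by rewrite le_max lexx.
have m2 : s / 2 <= Num.max 1 (Num.sqrt (q / 2)).
  rewrite le_max; apply/orP; right.
  have -> : s / 2 = Num.sqrt ((s / 2) ^+ 2) by rewrite sqrtr_sqr ger0_norm // divr_ge0 // ltW.
  rewrite ler_sqrt ?divr_ge0 ?ltW // qs expr_div_n.
  by have := sqr_ge0 s; lra.
move: (Num.max _ _) m1 m2 => m m1 m2 /=.
have [s1|s1] := leP 1 s.
  split; first by lra.
  split; first by lra.
  have -> : 2 * q / (1 / 2) + 2 * (1 / 2) = 4 * s ^+ 2 + 1 by rewrite qs; field.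
  nra.
split; first by lra.
split; first by lra.
have -> : 2 * q / (s / 2) + 2 * (s / 2) = 5 * s by rewrite qs; field; exact: lt0r_neq0.
nra.
Qed.

Lemma nat_between_double (R : realType) (r : R) : 1 <= r ->
  exists N : nat, (0 < N)%N /\ r <= N%:R /\ N%:R <= 2 * r.
Proof.
move=> r1; exists (Num.truncn r).+1; have r0 : 0 <= r by lra.
have := truncn_itv r0 => /andP[a b]; split => //; split; first exact: ltW.
by rewrite -natr1; lra.
Qed.

(** * Exponential moment of the deviation and Markov's inequality *)

Section deviation.
Context (R : realType) (n l N : nat) (N0 : (0 < N)%N) (n0 : (0 < n)%N).
Context d0 (T0 : measurableType d0) (P0 : probability T0 R) (Z : {RV P0 >-> borel_mx R l}).
Context d (T : measurableType d) (P : probability T R) (Zs : 'I_n -> {RV P >-> borel_mx R l}).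
Context (S : 'M[R]_l) (eta y : R).
Hypothesis psdZ : {ae P0, forall x, psdmx (mx_of (Z x))}.
Hypothesis meanZ : has_mean P0 (fun x => mx_of (Z x)) S.
Hypothesis S0 : 0 < opnorm S.
Hypothesis trS : \tr S <= N%:R * opnorm S.
Hypothesis eta1 : 1 <= eta.
Hypothesis mom : forall (p : R) (u : 'cV[R]_l), 1 <= p ->
  ('E_P0[fun x => (`|qform (mx_of (Z x)) u| `^ p)%R] `^ p^-1
    <= (eta * p * mxseminorm S u ^+ 2)%:E)%E.
Hypothesis idZ : forall i : 'I_n, identically_distributed (Zs i) Z.
Hypothesis indZ : mutually_independent Zs.
Hypothesis y0 : 0 < y.
Hypothesis y2 : y <= 2^-1.

Local Notation cube := {ffun 'I_l * 'I_N -> bool}.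

(** The moment scale [M] of [mgf_bil]: it bounds [eta * qform S] at every good vector. *)
Definition radius : R := eta * (64 * opnorm S).

(** The exponential parameter, normalized so that [expR 1 * rate * radius = y]. *)
Definition rate : R := y / (expR 1 * radius).

Definition deviation (w : T) : 'M[R]_l := n%:R^-1 *: (\sum_(i < n) mx_of (Zs i w)) - S.

(** The factor [n] turns the empirical mean into a sum over the sample. Outside the good pairs the
    exponent vanishes, so its exponential is 1. *)
Definition exponent (x z : cube) (w : T) : R :=
  rate * n%:R * ((good S x && good S z)%:R * bil (deviation w) (avg x) (avg z)).

Definition partition_fun (w : T) : R :=
  \sum_(x : cube) \sum_(z : cube) (2 ^+ #|{: 'I_l * 'I_N}|)^-1 ^+ 2 * expR (exponent x z w).

Lemma radius_gt0 : 0 < radius.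
Proof. by rewrite /radius mulr_gt0 ?(lt_le_trans ltr01 eta1) // mulr_gt0. Qed.

Lemma rate_gt0 : 0 < rate.
Proof. by rewrite divr_gt0 // mulr_gt0 ?expR_gt0 // radius_gt0. Qed.

Lemma rateE : expR 1 * rate * radius = y.
Proof.
rewrite /rate; field; rewrite !lt0r_neq0 ?expR_gt0 //; exact: radius_gt0.
Qed.

Lemma measurable_deviation i j : measurable_fun setT (fun w => deviation w i j).
Proof.
under eq_fun => w.
  rewrite !mxE summxE; over.
apply: measurable_funB => //; apply: measurable_funM => //.
by apply: measurable_sum => k; exact: measurable_entry_RV.
Qed.

Lemma measurable_exponent x z : measurable_fun setT (exponent x z).
Proof.
apply: measurable_funM => //; apply: measurable_funM => //.
exact: measurable_bil measurable_deviation.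
Qed.

Lemma measurable_partition_fun : measurable_fun setT partition_fun.
Proof.
apply: measurable_sum => x; apply: measurable_sum => z; apply: measurable_funM => //.
by apply: measurableT_comp => //; exact: measurable_exponent.
Qed.

Lemma integral_expR_exponent x z :
  (\int[P]_w (expR (exponent x z w))%:E <= (expR (n%:R * (2 * y ^+ 2)))%:E)%E.
Proof.
rewrite /exponent; case: (boolP (good S x && good S z)) => [/andP[gx gz]|_]; last first.
  under eq_integral do rewrite mul0r mulr0 expR0.
  rewrite integral_cst // mul1e; apply: le_trans (probability_le1 P measurableT) _.
  by rewrite lee_fin -[leLHS]expR0 ler_expR mulr_ge0 // mulr_ge0 // sqr_ge0.
pose g (M : borel_mx R l) : R :=
  expR (rate * (bil (mx_of M) (avg x) (avg z) - bil S (avg x) (avg z))).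
have mg : measurable_fun setT g.
  apply: measurableT_comp => //; apply: measurable_funM => //; apply: measurable_funB => //.
  exact: (measurable_bil (A := fun M : borel_mx R l => mx_of M) _ _ (@measurable_entry R l)).
have -> : (\int[P]_w (expR (rate * n%:R * (1 * bil (deviation w) (avg x) (avg z))))%:E =
    \int[P]_w (\prod_(i < n) g (Zs i w))%:E)%E.
  apply: eq_integral => w _; rewrite -expR_sum; congr (expR _)%:E.
  rewrite -mulr_sumr -mulrA mul1r; congr (_ * _).
  rewrite sumrB sumr_const card_ord bilB bilZ bil_summx mulrBr mulrA.
  rewrite -[_ *+ n in RHS]mulr_natl.
  by rewrite mulfV ?mul1r // pnatr_eq0 -lt0n.
rewrite expRM_natl -[X in (_ ^+ X)%:E]card_ord -prodr_const.
apply: (integral_prod_le (g := fun=> g) indZ) => [//|i M|i]; first exact: expR_ge0.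
(* Each factor depends only on the law of [Zs i], so it is computed with [Z] on the other
   probability space. *)
rewrite -(ge0_integral_distribution (Zs i) (f := EFin \o g)); last 2 first.
- exact/measurable_EFinP.
- by move=> M; rewrite lee_fin expR_ge0.
rewrite (eq_measure_integral (distribution P0 Z)); last by move=> A mA _; exact: idZ.
rewrite (ge0_integral_distribution Z (f := EFin \o g)); last 2 first.
- exact/measurable_EFinP.
- by move=> M; rewrite lee_fin expR_ge0.
rewrite -[in leRHS]rateE.
have e0 : 0 <= eta := le_trans ler01 eta1.
apply: (mgf_bil psdZ meanZ mom) => //.
- exact: ltW rate_gt0.
- by rewrite ler_wpM2l.
- by rewrite ler_wpM2l.
- by rewrite rateE.
Qed.

Lemma integral_partition_fun :
  (\int[P]_w (partition_fun w)%:E <= (expR (n%:R * (2 * y ^+ 2)))%:E)%E.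
Proof.
pose mu : R := (2 ^+ #|{: 'I_l * 'I_N}|)^-1 ^+ 2.
have mu0 : 0 <= mu by rewrite exprn_ge0 // invr_ge0 exprn_ge0.
have me (x z : cube) : measurable_fun setT (fun w => (mu * expR (exponent x z w))%:E).
  apply/measurable_EFinP; apply: measurable_funM => //.
  by apply: measurableT_comp => //; exact: measurable_exponent.
have e0 (x z : cube) w : (0 <= (mu * expR (exponent x z w))%:E)%E.
  by rewrite lee_fin mulr_ge0 ?expR_ge0.
have -> : (\int[P]_w (partition_fun w)%:E =
    \sum_(x : cube) \sum_(z : cube) \int[P]_w (mu * expR (exponent x z w))%:E)%E.
  transitivity (\int[P]_w \sum_(x : cube) \sum_(z : cube) (mu * expR (exponent x z w))%:E)%E.
    apply: eq_integral => w _; rewrite -sumEFin; apply: eq_bigr => x _.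
    by rewrite -sumEFin.
  rewrite ge0_integral_sum //; last 2 first.
  - by move=> x; exact: emeasurable_sum.
  - by move=> x w _; exact: sume_ge0.
  by apply: eq_bigr => x _; rewrite ge0_integral_sum.
set E := expR _.
apply: (@le_trans _ _ (\sum_(x : cube) \sum_(z : cube) (mu * E)%:E)%E).
  apply: lee_sum => x _; apply: lee_sum => z _.
  under eq_integral do rewrite EFinM.
  rewrite ge0_integralZl_EFin //; last first.
    apply/measurable_EFinP.
    by apply: measurableT_comp => //; exact: measurable_exponent.
  by rewrite (EFinM mu E); apply: lee_wpmul2l => //; exact: integral_expR_exponent.
rewrite (eq_bigr (fun=> (\sum_(z : cube) (mu * E))%:E)); last by move=> x _; rewrite sumEFin.
rewrite sumEFin lee_fin !sumr_const card_ffun card_bool.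
by rewrite -mulrnA -mulr_natl natrM natrX /mu mulrA exprVn -expr2 mulfV ?mul1r.
Qed.

(** Taking logarithms in [gibbs_cube] bounds [rate * n] times the averaged truncated form by
    [2 * N + t + 2 * n * y ^+ 2]. Division by [rate * n] gives the bound, up to the factor 16/7 of
    the truncation. *)
Lemma opnorm_deviation_le (t : R) (w : T) : 0 <= t ->
  partition_fun w < expR (t + n%:R * (2 * y ^+ 2)) ->
  opnorm (deviation w) <=
    16 / 7 * (expR 1 * radius * ((2 * N%:R + t) / n%:R / y + 2 * y)).
Proof.
move=> t0 Dw.
have n0' : 0 < n%:R :> R by rewrite ltr0n.
have r0 := rate_gt0; have R0 := radius_gt0.
apply: (opnorm_le_truncated N0 (psdmx_mean psdZ meanZ) S0 trS).
  rewrite mulr_ge0 //; first by rewrite mulr_ge0 ?expR_ge0 ?ltW.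
  by rewrite addr_ge0 ?divr_ge0 ?addr_ge0 ?mulr_ge0 // ltW.
move=> u v u1 v1.
have := gibbs_cube N0 (fun x z => exponent x z w) u1 v1.
move=> /le_lt_trans; rewrite -/(partition_fun w) => /(_ (expR (2 * N%:R + (t + n%:R * (2 * y ^+ 2))))).
rewrite [X in _ < X -> _]expRD ltr_pM2l ?expR_gt0 // => /(_ Dw).
rewrite ltr_expR => H.
have E : \sum_(x : cube) \sum_(z : cube) tiltv u x * tiltv v z * exponent x z w =
   (rate * n%:R) * \sum_(x : cube) \sum_(z : cube) tiltv u x * tiltv v z *
     ((good S x && good S z)%:R * bil (deviation w) (avg x) (avg z)).
  rewrite mulr_sumr; apply: eq_bigr => x _; rewrite mulr_sumr; apply: eq_bigr => z _.
  by rewrite /exponent mulrCA.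
rewrite E in H.
have rn : 0 < rate * n%:R by rewrite mulr_gt0.
move: H; rewrite mulrC -ltr_pdivlMr // => /ltW/le_trans; apply.
rewrite le_eqVlt; apply/orP; left; apply/eqP; rewrite /rate; field.
by rewrite !lt0r_neq0 ?expR_gt0.
Qed.

(** Markov's inequality for [partition_fun], at [expR t] times the bound on its mean. *)
Lemma probability_opnorm_deviation (t c : R) : 0 <= t -> 0 <= c ->
  16 / 7 * (expR 1 * radius * ((2 * N%:R + t) / n%:R / y + 2 * y)) <= c ->
  ((1 - expR (- t))%:E <= P [set w | (opnorm (deviation w) <= c)%R])%E.
Proof.
move=> t0 c0 bc; set a := expR (t + n%:R * (2 * y ^+ 2)).
have a0 : 0 < a by exact: expR_gt0.
have D0 w : 0 <= partition_fun w.
  apply: sumr_ge0 => x _; apply: sumr_ge0 => z _.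
  by rewrite mulr_ge0 ?expR_ge0 // exprn_ge0 // invr_ge0 exprn_ge0.
pose B := [set w | a <= partition_fun w].
have mB : measurable B.
  rewrite (_ : B = [set: T] `&` partition_fun @^-1` `[a, +oo[).
    exact: measurable_partition_fun.
  by rewrite setTI; apply/seteqP; split => w /=; rewrite /B /= in_itv /= andbT.
have PB : (P B <= (expR (- t))%:E)%E.
  have := @le_integral_abse _ _ _ P setT measurableT (EFin \o partition_fun) a
    (proj2 (measurable_EFinP _ _) measurable_partition_fun) a0.
  rewrite setTI (_ : [set x | _] = B); last first.
    by apply/seteqP; split => w /=; rewrite /B /= ger0_norm // lee_fin.
  under eq_integral do rewrite /= ger0_norm //.
  move=> /le_trans/(_ integral_partition_fun).
  rewrite -lee_pdivlMl // => /le_trans; apply.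
  by rewrite -EFinM lee_fin /a -expRN -expRD opprD subrK.
have mG : measurable [set w | opnorm (deviation w) <= c].
  exact: measurable_opnorm_le measurable_deviation.
apply: (@le_trans _ _ (P (~` B))).
  rewrite probability_setC // EFinB leeB //.
apply: le_measure => [||w /=]; [exact: mem_set (measurableC mB)|exact: mem_set mG|].
rewrite /B /= => /negP; rewrite -ltNge => Dw.
exact: le_trans (opnorm_deviation_le t0 Dw) bc.
Qed.

End deviation.

Theorem theorem3 (R : realType) :
  exists c : R, 0 < c /\
  forall (n l : nat), (1 <= n)%N -> (1 <= l)%N ->
  forall (d0 : measure_display) (T0 : measurableType d0) (P0 : probability T0 R)
    (Z : {RV P0 >-> borel_mx R l})
    (d : measure_display) (T : measurableType d) (P : probability T R)
    (Zs : 'I_n -> {RV P >-> borel_mx R l})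
    (Sigma : 'M[R]_l) (eta : R),
  {ae P0, forall x, psdmx (mx_of (Z x))} ->
  has_mean P0 (fun x => mx_of (Z x)) Sigma ->
  Sigma != 0 ->
  1 <= eta ->
  (forall (p : R) (u : 'cV[R]_l), 1 <= p ->
     ('E_P0[fun x => (`|qform (mx_of (Z x)) u| `^ p)%R] `^ p^-1
        <= (eta * p * mxseminorm Sigma u ^+ 2)%:E)%E) ->
  (forall i : 'I_n, identically_distributed (Zs i) Z) ->
  mutually_independent Zs ->
  forall t : R, 0 <= t ->
  ((1 - expR (- t))%:E <=
   P [set w | (opnorm (n%:R^-1 *: (\sum_(i < n) mx_of (Zs i w)) - Sigma)
       <= c * eta * opnorm Sigma * Num.sqrt ((2 * reff Sigma + t) / n%:R)
          * Num.max 1 (Num.sqrt ((reff Sigma + t / 2) / n%:R)))%R])%E.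
Proof.
have e0 : 0 < expR 1 :> R by exact: expR_gt0.
(* 16/7 comes from absorbing the truncation error, [expR 1] from the bound on [k ^+ k / k!], 64 from
   the cut-off level and 10 from [rate_le]. *)
exists (16 / 7 * (expR 1 * (64 * 10))); split; first by rewrite mulr_gt0 ?divr_gt0 // mulr_gt0 // mulr_gt0.
move=> n l n1 l1 d0 T0 P0 Z d T P Zs S eta psdZ meanZ S0 eta1 mom idZ indZ t t0.
have o0 := opnorm_gt0 S0; have psdS := psdmx_mean psdZ meanZ.
have r1 : 1 <= reff S by rewrite /reff ler_pdivlMr // mul1r; exact: psdmx_opnorm_trace.
(* The lower bound on [N] gives [\tr S <= N * opnorm S]; the upper bound keeps the cost [2 * N]
   proportional to the effective rank. *)
have [N [N0 [rN Nr]]] := nat_between_double r1.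
have n0 : 0 < n%:R :> R by rewrite ltr0n.
set q := (2 * reff S + t) / n%:R.
have q0 : 0 < q by rewrite divr_gt0 //; lra.
have -> : (reff S + t / 2) / n%:R = q / 2 by rewrite /q; field; exact: lt0r_neq0.
have [] := rate_le q0; set y := _ / 2 => y0 [y2 yb].
have trS : \tr S <= N%:R * opnorm S by rewrite -ler_pdivrMr.
set m := Num.max _ _ in yb *.
have m0 : 0 <= m by rewrite le_max ler01.
apply: (probability_opnorm_deviation (y := y) N0 n1 psdZ meanZ o0 trS eta1 mom idZ indZ y0 y2 t0).
  by rewrite !mulr_ge0 ?sqrtr_ge0 //; lra.
(* From [N <= 2 * reff S] one gets [2 * N + t <= 2 * (2 * reff S + t)], whence the factor 2 before
   [q] in [rate_le]. *)
have h : (2 * N%:R + t) / n%:R / y + 2 * y <= 10 * (Num.sqrt q * m).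
  apply: le_trans yb; rewrite lerD2r ler_pM2r ?invr_gt0 //.
  by rewrite /q mulrA ler_pM2r ?invr_gt0 //; lra.
rewrite /radius.
have K0 : 0 <= expR 1 * (eta * (64 * opnorm S)).
  by rewrite !mulr_ge0 ?expR_ge0 ?opnorm_ge0 //; lra.
rewrite [leRHS](_ : _ = 16 / 7 * (expR 1 * (eta * (64 * opnorm S)) * (10 * (Num.sqrt q * m)))).
  by rewrite ler_wpM2l ?divr_ge0 // ler_wpM2l.
ring.
Qed.
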